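(* Let $d\ge 2$ and $\sigma>0$ satisfy $\sigma\sqrt{\ln(4/\sigma)}\le \frac{1}{32d}$, and let $n=\lfloor (4/\sigma)^d\rfloor$. There exist $\bar A\in\mathbb{R}^{n\times d}$ and $\bar b\in\mathbb{R}^n$ such that each row of the combined matrix $(\bar A,\bar b)$ has Euclidean norm at most $1$ and the following holds. If $A\in\mathbb{R}^{n\times d}$, $b\in\mathbb{R}^n$ have independent Gaussian entries with variance $\sigma^2$ and expectations $\mathbb{E}[A]=\bar A$, $\mathbb{E}[b]=\bar b$, then \[ \Pr\left[\operatorname{diam}(\{x: Ax\le b\}) \ge \frac{(d-1)^{1/2}}{24\sqrt{\sigma\sqrt{\ln(4/\sigma)}}}\right]\ge 1-n^{-d}. \] Moreover, with probability at least $1-n^{-d}$, for every nonzero objective $c\in\mathbb{R}^d$, the combinatorial distance between a maximizing vertex and a minimizing vertex of $c$ over $\{x:Ax\le b\}$ is at least $\frac{(d-1)^{1/2}}{24\sqrt{\sigma\sqrt{\ln(4/\sigma)}}}$.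
   Context: The combinatorial distance between two vertices of a polyhedron is the minimum number of edges of a path between them in the graph of vertices and edges of the polyhedron; the combinatorial diameter $\operatorname{diam}$ is the maximum combinatorial distance over all pairs of vertices. *)

(* Defs.v *)
From HB Require Import structures.
From mathcomp Require Import all_boot all_order all_algebra.
From mathcomp Require Import all_classical all_reals all_analysis.
Set Implicit Arguments. Unset Strict Implicit. Unset Printing Implicit Defensive.
Import Order.TTheory GRing.Theory Num.Theory.
Local Open Scope classical_set_scope.
Local Open Scope ring_scope.

Section Polyhedra.
Variables (R : realType) (n d : nat).

Definition dotv (c x : 'cV[R]_d) : R := \sum_(j < d) c j 0 * x j 0.

Definition polyhedron (A : 'M[R]_(n, d)) (b : 'cV[R]_n) : set 'cV[R]_d :=
  [set x | forall i : 'I_n, (A *m x) i 0 <= b i 0].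

Definition is_face (P F : set 'cV[R]_d) : Prop :=
  exists (c : 'cV[R]_d) (delta : R),
    (forall x, P x -> dotv c x <= delta) /\
    F = [set x | P x /\ dotv c x = delta].

Definition is_vertex (P : set 'cV[R]_d) (v : 'cV[R]_d) : Prop :=
  is_face P [set v].

Definition segment (u v : 'cV[R]_d) : set 'cV[R]_d :=
  [set x | exists t : R, 0 <= t <= 1 /\ x = (1 - t) *: u + t *: v].

Definition adjacent (P : set 'cV[R]_d) (u v : 'cV[R]_d) : Prop :=
  [/\ is_vertex P u, is_vertex P v, u <> v & is_face P (segment u v)].

Inductive walk (E : 'cV[R]_d -> 'cV[R]_d -> Prop) :
    'cV[R]_d -> 'cV[R]_d -> nat -> Prop :=
| walk0 u : walk E u u 0
| walkS u w v k : E u w -> walk E w v k -> walk E u v k.+1.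

(* combinatorial distance (+oo if not connected) *)
Definition comb_dist (P : set 'cV[R]_d) (u v : 'cV[R]_d) : \bar R :=
  ereal_inf [set (k%:R)%:E | k in [set k | walk (adjacent P) u v k]].

Definition comb_diam (P : set 'cV[R]_d) : \bar R :=
  ereal_sup [set comb_dist P u v | u in is_vertex P & v in is_vertex P].

Definition maximizing_vertex (P : set 'cV[R]_d) (c v : 'cV[R]_d) : Prop :=
  is_vertex P v /\ forall x, P x -> dotv c x <= dotv c v.

Definition minimizing_vertex (P : set 'cV[R]_d) (c v : 'cV[R]_d) : Prop :=
  is_vertex P v /\ forall x, P x -> dotv c v <= dotv c x.

End Polyhedra.

Definition entry_index (n d : nat) : finType := (('I_n * 'I_d) + 'I_n)%type.

Definition entry_of {R : realType} {T : Type} {n d : nat}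
  (A : T -> 'M[R]_(n, d)) (b : T -> 'cV[R]_n) (j : entry_index n d) (t : T) : R :=
  match j with inl ij => A t ij.1 ij.2 | inr i => b t i 0 end.

Definition mutually_independent {R : realType} {dT : measure_display}
  {T : measurableType dT} (P : probability T R) (I : finType) (Y : I -> T -> R) : Prop :=
  forall B : I -> set R, (forall j, measurable (B j)) ->
    P (\bigcap_(j in [set: I]) (Y j @^-1` B j)) = (\prod_(j : I) P (Y j @^-1` B j))%E.

(* Main.v *)
(* The rows of the mean system are 7/10 times a dense set of unit vectors, with
   right-hand side 7/10.  Gaussian concentration (a Chernoff bound for each row)
   keeps the perturbed polyhedron between the balls of radius 1 - H and 1 / (1 - H),
   where H = 5 d sigma sqrt(ln(4 / sigma)).  A facet misses the inner ball and lies
   in the outer one, so it has diameter O(sqrt H).  Almost surely no d + 1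
   constraints are tight at a common point; then each edge of a walk drops at most
   one tight constraint, so d - 1 consecutive edges share a facet, and d - 1 steps
   of a walk only cover a distance O(sqrt H).  Optimal vertices of opposite
   objectives are at distance at least 2 (1 - H), whence the factor sqrt(d - 1). *)

Require Import Defs.
From HB Require Import structures.
From mathcomp Require Import all_boot all_order all_algebra.
From mathcomp Require Import all_classical all_reals all_analysis.
From mathcomp Require Import measurable_realfun.
From mathcomp Require Import ring lra zify.
Set Implicit Arguments.
Unset Strict Implicit.
Unset Printing Implicit Defensive.
Import Order.TTheory GRing.Theory Num.Theory.
Import numFieldNormedType.Exports.
Local Open Scope classical_set_scope.
Local Open Scope ring_scope.

(** * Tight constraints along walks *)

(** Two obstacles shape the proof. The events of the theorem quantify over vertices and objectives,
    and no measurability is established for them; each claim is therefore made through a measurable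
    subset, and one good event serves both. Degeneracy likewise asks for the existence of a point,
    so it is covered by finitely many product events at one fixed resolution [N]. The failure
    probability n^-d is split evenly between this cover, made small by the choice of [N], and the
    row deviations. Constants: 7/10 keeps the combined rows in the unit ball, as 2 (7/10)^2 =
    98/100. In H = 5 d kappa, with kappa = sigma sqrt(ln(4 / sigma)), the share 9/2 must make the
    Chernoff exponent beat n^(d + 1), and 1/2 is left to the net. The bound d kappa <= 1/32 gives (1
    - H)^4 >= (27/32)^4 > 1/2, barely enough for half the diameter of a facet to stay below the
    inner radius. The factor 24 has slack: the computation gives sqrt(320) < 18. *)

Section EuclideanNorm.
Variables (R : realType) (d : nat).
Implicit Types (x y z c : 'cV[R]_d) (a : R).

Lemma dotvC x y : dotv x y = dotv y x.
Proof. by apply: eq_bigr => j _; rewrite mulrC. Qed.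

Lemma dotvDr c x y : dotv c (x + y) = dotv c x + dotv c y.
Proof. by rewrite -big_split; apply: eq_bigr => j _; rewrite mxE mulrDr. Qed.

Lemma dotvZr c a x : dotv c (a *: x) = a * dotv c x.
Proof. by rewrite mulr_sumr; apply: eq_bigr => j _; rewrite mxE mulrCA. Qed.

Lemma dotvNr c x : dotv c (- x) = - dotv c x.
Proof. by rewrite -scaleN1r dotvZr mulN1r. Qed.

Lemma dotvBr c x y : dotv c (x - y) = dotv c x - dotv c y.
Proof. by rewrite dotvDr dotvNr. Qed.

Lemma dotvDl x y c : dotv (x + y) c = dotv x c + dotv y c.
Proof. by rewrite dotvC dotvDr !(dotvC c). Qed.

Lemma dotvZl a x c : dotv (a *: x) c = a * dotv x c.
Proof. by rewrite dotvC dotvZr dotvC. Qed.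

Lemma dotvNl x c : dotv (- x) c = - dotv x c.
Proof. by rewrite dotvC dotvNr dotvC. Qed.

Lemma dotvBl x y c : dotv (x - y) c = dotv x c - dotv y c.
Proof. by rewrite dotvDl dotvNl. Qed.

Lemma dotv_ge0 x : 0 <= dotv x x.
Proof. by apply: sumr_ge0 => j _; rewrite -expr2 sqr_ge0. Qed.

Lemma dotv_eq0 x : (dotv x x == 0) = (x == 0).
Proof.
apply/idP/eqP => [|->]; last by rewrite /dotv big1// => j _; rewrite mxE mul0r.
rewrite psumr_eq0; last by move=> j _; rewrite -expr2 sqr_ge0.
move=> /allP h; apply/colP => j; rewrite mxE.
by have := h j (mem_index_enum _); rewrite /= -expr2 sqrf_eq0 => /eqP.
Qed.

Definition enorm x : R := Num.sqrt (dotv x x).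

Lemma enorm_ge0 x : 0 <= enorm x. Proof. exact: sqrtr_ge0. Qed.

Lemma enorm_sqr x : enorm x ^+ 2 = dotv x x.
Proof. by rewrite sqr_sqrtr// dotv_ge0. Qed.

Lemma enorm_eq0 x : (enorm x == 0) = (x == 0).
Proof. by rewrite -sqrf_eq0 enorm_sqr dotv_eq0. Qed.

Lemma enormZ a x : enorm (a *: x) = `|a| * enorm x.
Proof.
by rewrite /enorm dotvZl dotvZr mulrA -expr2 sqrtrM ?sqr_ge0// sqrtr_sqr.
Qed.

Lemma enormN x : enorm (- x) = enorm x.
Proof. by rewrite -scaleN1r enormZ normrN1 mul1r. Qed.

Lemma cauchy_schwarz x y : dotv x y <= enorm x * enorm y.
Proof.
have [->|x0] := eqVneq x 0.
  by rewrite -(scale0r x) dotvZl mul0r mulr_ge0 ?enorm_ge0.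
have x1 : 0 < enorm x by rewrite lt_neqAle eq_sym enorm_eq0 x0 enorm_ge0.
have := dotv_ge0 (enorm x ^+ 2 *: y - dotv x y *: x).
rewrite !dotvBl !dotvBr !dotvZl !dotvZr (dotvC y x) -enorm_sqr -(enorm_sqr x).
set p := dotv x y => h.
have {}h : p ^+ 2 <= (enorm x * enorm y) ^+ 2.
  rewrite -(ler_pM2l (exprn_gt0 2 x1)); lra.
rewrite (le_trans (ler_norm _))// -ler_sqr ?nnegrE ?mulr_ge0 ?enorm_ge0//.
by rewrite real_normK ?num_real.
Qed.

Lemma enormD x y : enorm (x + y) <= enorm x + enorm y.
Proof.
rewrite -ler_sqr ?nnegrE ?addr_ge0 ?enorm_ge0//.
rewrite enorm_sqr sqrrD !dotvDl !dotvDr (dotvC y x) !enorm_sqr.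
have := cauchy_schwarz x y; lra.
Qed.

Lemma enorm_coord x j : `|x j 0| <= enorm x.
Proof.
rewrite -ler_sqr ?nnegrE ?enorm_ge0// enorm_sqr real_normK ?num_real//.
rewrite /dotv (bigD1 j)//= -expr2 lerDl; apply: sumr_ge0 => i _.
by rewrite -expr2 sqr_ge0.
Qed.

End EuclideanNorm.

Lemma mulmx_dotv (R : realType) (n d : nat) (A : 'M[R]_(n, d)) (x : 'cV[R]_d) i :
  (A *m x) i 0 = dotv (row i A)^T x.
Proof. by rewrite mxE; apply: eq_bigr => j _; rewrite !mxE. Qed.

Section PolyhedronWalks.
Variables (R : realType) (n d : nat) (A : 'M[R]_(n, d)) (b : 'cV[R]_n).
Implicit Types (x y u v : 'cV[R]_d).
Local Notation P := (polyhedron A b).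

Definition tight x : {set 'I_n} := [set i | (A *m x) i 0 == b i 0].

Lemma vertex_in_polyhedron v : is_vertex P v -> P v.
Proof. by move=> [c [delta [_ h]]]; have : [set v] v by []; rewrite h => -[]. Qed.

(** A matrix with [d] rows and fewer than [d] columns has a nonzero left kernel. The index type is
    arbitrary so that an extra functional can join the rows of [A]. *)
Lemma common_kernel (I : finType) (S : {set I}) (f : I -> 'cV[R]_d) :
  (#|S| < d)%N -> exists2 y, y != 0 & forall i, i \in S -> dotv (f i) y = 0.
Proof.
move=> Sd; pose M := \matrix_(i < d, j < #|S|) f (enum_val j) i 0.
have : kermx M != 0.
  rewrite -mxrank_eq0 mxrank_ker subn_eq0 -ltnNge.
  exact: leq_ltn_trans (rank_leq_col M) Sd.
move=> /rowV0Pn[w wM w0]; exists w^T.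
  by rewrite -(inj_eq (can_inj (@trmxK _ _ _))) trmxK trmx0.
move=> i iS; move: wM => /sub_kermxP /matrixP /(_ 0 (enum_rank_in iS i)).
rewrite !mxE => <-; apply: eq_bigr => j _.
by rewrite !mxE enum_rankK_in// mulrC.
Qed.

Lemma perturb_along_tight x y : P x ->
  (forall i, i \in tight x -> dotv (row i A)^T y = 0) ->
  exists2 e, 0 < e & P (x + e *: y) /\ P (x - e *: y).
Proof.
move=> Px hy.
pose g i := dotv (row i A)^T y.
pose s i := b i 0 - (A *m x) i 0.
(* The [1 +] keeps the quotient meaningful for a constraint that is constant along [y]; the initial
   value 1 covers the absence of slack constraints. *)
pose e := \big[Num.min/1]_(i | i \notin tight x) (s i / (1 + `|g i|)).
have s0 i : i \notin tight x -> 0 < s i.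
  by rewrite inE subr_gt0 lt_neqAle => ->; exact: Px.
have e0 : 0 < e.
  rewrite /e; elim/big_ind: _ => //[u v u0 v0|i /s0 si].
    by rewrite lt_min u0.
  by rewrite divr_gt0// ltr_wpDr.
exists e => //.
have key i : e * `|g i| <= s i.
  have [it|it] := boolP (i \in tight x).
    by rewrite [g i]hy// normr0 mulr0 subr_ge0; exact: Px.
  have : e <= s i / (1 + `|g i|) by rewrite /e (bigD1 i)//= ge_min lexx.
  rewrite ler_pdivlMr ?ltr_wpDr// mulrDr mulr1; lra.
have h i : e * g i <= s i /\ - (e * g i) <= s i.
  have h1 : e * g i <= e * `|g i| by rewrite ler_pM2l// ler_norm.
  have h2 : e * - g i <= e * `|g i| by rewrite ler_pM2l// -normrN ler_norm.
  by rewrite -mulrN; split; apply: le_trans (key i).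
split => i; have [h1 h2] := h i.
  rewrite mulmx_dotv dotvDr dotvZr -mulmx_dotv -/(g i).
  by move: h1; rewrite /s; lra.
rewrite mulmx_dotv dotvBr dotvZr -mulmx_dotv -/(g i).
by move: h2; rewrite /s; lra.
Qed.

(** A short step along [y] and one along [- y] both stay in [P], and [c] cannot exceed its maximum
    [delta] at either end, so [c] is constant along [y]. *)
Lemma face_direction F c delta x y :
  (forall x, P x -> dotv c x <= delta) -> F = [set x | P x /\ dotv c x = delta] ->
  F x -> (forall i, i \in tight x -> dotv (row i A)^T y = 0) ->
  exists2 e, 0 < e & F (x + e *: y).
Proof.
move=> hc -> [Px cx] /(perturb_along_tight Px)[e e0 [P1 P2]].
exists e => //; split => //.
have := hc _ P1; have := hc _ P2.
rewrite !dotvDr dotvNr !dotvZr cx; nra.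
Qed.

Lemma vertex_tight v : is_vertex P v -> (d <= #|tight v|)%N.
Proof.
move=> [c [delta [hc hF]]]; rewrite leqNgt; apply/negP.
move=> /(common_kernel (fun i => (row i A)^T))[y y0 hy].
have [e e0] := face_direction hc hF (erefl v) hy.
move=> /eqP; rewrite -subr_eq0 addrAC subrr add0r scaler_eq0 (negPf y0) orbF.
by rewrite gt_eqF.
Qed.

(** The tight constraints of the midpoint are common to both ends. With fewer than [d - 1] of them,
    a nonzero direction orthogonal to [v - u] keeps them all tight and hence stays in the edge,
    which is impossible. *)
Lemma adjacent_tight u v : Defs.adjacent P u v ->
  (d.-1 <= #|tight u :&: tight v|)%N.
Proof.
move=> [/vertex_in_polyhedron Pu /vertex_in_polyhedron Pv uv [c [delta [hc hF]]]].
rewrite leqNgt; apply/negP => Td.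
pose m := (1 - 2^-1) *: u + 2^-1 *: v.
have mseg : segment u v m by exists 2^-1; split => //; apply/andP; split; lra.
have tm i : i \in tight m -> i \in tight u :&: tight v.
  have := Pu i; have := Pv i.
  rewrite !inE !mulmx_dotv dotvDr !dotvZr => h1 h2 /eqP h3.
  by apply/andP; split; apply/eqP; lra.
pose f o := if o is Some i then (row i A)^T else v - u.
have [|y y0 hy] := @common_kernel _ (None |: (Some @: (tight u :&: tight v))) f.
  rewrite cardsU1 card_imset; last exact: Some_inj.
  have -> : None \notin Some @: (tight u :&: tight v) by apply/imsetP => -[].
  by rewrite add1n; lia.
have hy0 : dotv (v - u) y = 0 by apply: (hy None); rewrite !inE.
have hyt i : i \in tight m -> dotv (row i A)^T y = 0.
  by move=> /tm it; apply: (hy (Some i)); rewrite finset.in_setU imset_f ?orbT.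
have [e e0 [t [_ ht]]] := face_direction hc hF mseg hyt.
have ey : e *: y = (t - 2^-1) *: (v - u).
  move: ht; rewrite /m => /(canRL (addKr _)) ->; apply/colP => j.
  rewrite !mxE; ring.
have : dotv y y = 0.
  have : e * dotv y y = 0.
    by rewrite -dotvZr ey dotvZr dotvC hy0 mulr0.
  by move=> /eqP; rewrite mulf_eq0 gt_eqF//= => /eqP.
by move=> /eqP; rewrite dotv_eq0 (negPf y0).
Qed.

Hypothesis nondegenerate : forall x, P x -> (#|tight x| <= d)%N.

(* Each edge of a walk drops at most one tight constraint. *)
Lemma walk_common_tight u v k : walk (Defs.adjacent P) u v k -> is_vertex P v ->
  exists2 S : {set 'I_n}, S \subset tight u :&: tight v & (d - k <= #|S|)%N.
Proof.
elim=> [{}u /vertex_tight du|{}u w {}v {}k uw _ IH vv].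
  by exists (tight u); rewrite ?finset.setIid ?subn0.
have [S Swv dS] := IH vv; exists (S :&: tight u).
  rewrite finset.subsetI finset.subsetIr/=.
  exact: fintype.subset_trans (finset.subsetIl _ _) (fintype.subset_trans Swv (finset.subsetIr _ _)).
have wd : (#|tight w| <= d)%N.
  by apply: nondegenerate; case: uw => _ /vertex_in_polyhedron.
have uwd := adjacent_tight uw.
(* At most [d] constraints are tight at [w] and at least [d - 1] of them remain tight at [u], so [S]
   loses at most one element. *)
have : (#|S :\: tight u| <= #|tight w :\: tight u|)%N.
  by rewrite subset_leq_card// finset.setSD// (fintype.subset_trans Swv)// finset.subsetIl.
have := cardsID (tight u) (tight w); have := cardsID (tight u) S.
rewrite (finset.setIC (tight w)); lia.
Qed.

Lemma walk_split u v k p : walk (Defs.adjacent P) u v k -> (p <= k)%N ->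
  exists2 w, walk (Defs.adjacent P) u w p & walk (Defs.adjacent P) w v (k - p).
Proof.
move=> uv; elim: uv p => [{}u|{}u w {}v {}k uw + IH] [|p]//.
- by move=> _; exists u; rewrite ?subn0; exact: walk0.
- by move=> wv; exists u; [exact: walk0|rewrite subn0; exact: walkS uw wv].
- by move=> wv /IH[w' w1 w2]; exists w'; [exact: walkS uw w1|].
Qed.

Lemma walk_vertex u v k : walk (Defs.adjacent P) u v k -> is_vertex P v -> is_vertex P u.
Proof. by case=> // {}u w {}v {}k []. Qed.

Variables r w : R.
Hypothesis r0 : 0 <= r.
Hypothesis w0 : 0 <= w.
Hypothesis ball_inside : forall x i, enorm x < r -> (A *m x) i 0 < b i 0.
Hypothesis inside_ball : forall x, P x -> enorm x ^+ 2 <= r ^+ 2 + w ^+ 2.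

(* The midpoint is tight at the same constraint, hence outside the open inner ball. *)
Lemma common_facet_dist u v i : P u -> P v -> i \in tight u -> i \in tight v ->
  enorm (u - v) <= 2 * w.
Proof.
move=> Pu Pv iu iv.
have mr : r <= enorm (2^-1 *: (u + v)).
  rewrite leNgt; apply/negP => /(ball_inside i).
  move: iu iv; rewrite !inE !mulmx_dotv dotvZr dotvDr => /eqP -> /eqP ->; lra.
move: mr; rewrite -ler_sqr ?nnegrE ?enorm_ge0// => mr.
rewrite -ler_sqr ?nnegrE ?enorm_ge0 ?mulr_ge0//.
(* Parallelogram identity: |u - v|^2 = 2 |u|^2 + 2 |v|^2 - |u + v|^2 <= 4 (r^2 + w^2) - 4 r^2. So
   [w] is half a chord of the outer sphere tangent to the inner one. *)
move: mr (inside_ball Pu) (inside_ball Pv); rewrite !enorm_sqr !dotvZl !dotvZr.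
rewrite !dotvDl !dotvDr !dotvNl !dotvNr (dotvC v u); lra.
Qed.

(** Cut the walk into blocks of at most [d - 1] edges: by [walk_common_tight] the ends of a block
    still share a tight constraint, and [common_facet_dist] bounds each block. *)
Lemma walk_dist u v k m : (1 < d)%N -> walk (Defs.adjacent P) u v k -> is_vertex P v ->
  (k <= m * d.-1)%N -> enorm (u - v) <= m%:R * (2 * w).
Proof.
move=> d1; elim: m u k => [|m IH] u k uv vv km.
  case: uv vv km => [{}v vv km|]; last by move=> ? ? ? k0; rewrite mul0n.
  by rewrite subrr mul0r -(scale0r v) enormZ normr0 mul0r.
have short u' v' k' : walk (Defs.adjacent P) u' v' k' -> is_vertex P v' ->
    (k' <= d.-1)%N -> enorm (u' - v') <= 2 * w.
  move=> uv' vv' kd; have [S Suv dS] := walk_common_tight uv' vv'.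
  have /card_gt0P[i /(fintype.subsetP Suv)] : (0 < #|S|)%N by lia.
  rewrite inE => /andP[iu iv].
  apply: common_facet_dist iu iv; last exact: vertex_in_polyhedron.
  exact: vertex_in_polyhedron (walk_vertex uv' vv').
have [kd|kd] := leqP k d.-1.
  apply: le_trans (short _ _ _ uv vv kd) _.
  by rewrite ler_peMl ?mulr_ge0// ler1n.
have [x ux xv] := walk_split uv (ltnW kd).
rewrite -(subrK x u) -addrA; apply: le_trans (enormD _ _) _.
have h1 := short _ _ _ ux (walk_vertex xv vv) (leqnn _).
have h2 : enorm (x - v) <= m%:R * (2 * w).
  by apply: IH xv vv _; rewrite leq_subLR -mulSn.
rewrite -(addn1 m) natrD; lra.
Qed.

Lemma walk_length u v k : (1 < d)%N -> w < r -> walk (Defs.adjacent P) u v k ->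
  is_vertex P v -> 2 * r <= enorm (u - v) -> d.-1%:R * r <= 2 * k%:R * w.
Proof.
move=> d1 wr uv vv ruv; have rp : 0 < r by exact: le_lt_trans wr.
have dp : (0 < d.-1)%N by lia.
have [k0|k0] := posnP k.
  have := walk_dist (m := 0) d1 uv vv; rewrite k0 mul0r => /(_ isT); lra.
(* The ceiling of k / (d - 1). Since [w < r] forces [m >= 2], it is at most twice the floor of (k -
   1) / (d - 1), so rounding costs only a factor 2. *)
have [m mE] : exists m, m = (k.-1 %/ d.-1).+1 by eexists.
have rm : r <= m%:R * w.
  have km : (k <= m * d.-1)%N by rewrite mE -[leqLHS](prednK k0) ltn_ceil.
  by have := walk_dist d1 uv vv km; lra.
have w1 : 0 < w.
  rewrite lt_neqAle w0 andbT eq_sym; apply/eqP => ww.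
  by move: rm; rewrite ww mulr0; lra.
have m2 : (2 <= m)%N.
  rewrite leqNgt; apply/negP => mm; have m1 : m = 1%N by apply/eqP; rewrite eqn_leq -ltnS mm mE.
  by move: rm; rewrite m1; lra.
have mk : (m * d.-1 <= 2 * k)%N.
  have h1 : (m * d.-1 <= (k.-1 %/ d.-1).*2 * d.-1)%N by rewrite leq_mul2r; lia.
  by have h2 := leq_divM k.-1 d.-1; rewrite -muln2 -mulnA mulnCA in h1; lia.
apply: le_trans (_ : d.-1%:R * (m%:R * w) <= _); first by rewrite ler_wpM2l.
rewrite mulrA -!natrM ler_wpM2r// ler_nat; lia.
Qed.

End PolyhedronWalks.

(** * Existence of vertices in bounded polyhedra *)

Section FarthestVertex.
Variables (R : realType) (n d : nat) (A : 'M[R]_(n, d)) (b : 'cV[R]_n).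
Local Notation P := (polyhedron A b).

Lemma continuous_dotv_trmx (c : 'cV[R]_d) :
  continuous (fun y : 'rV[R]_d => dotv c y^T).
Proof.
apply: continuous_big => [|j _]; first exact: add_continuous.
under eq_fun do rewrite mxE.
by move=> y; apply: continuousM; [exact: cst_continuous|exact: coord_continuous].
Qed.

Lemma continuous_sqdist_trmx (w : 'cV[R]_d) :
  continuous (fun y : 'rV[R]_d => dotv (y^T - w) (y^T - w)).
Proof.
apply: continuous_big => [|j _]; first exact: add_continuous.
have h : continuous (fun y : 'rV[R]_d => (y^T - w) j 0).
  under eq_fun do rewrite !mxE.
  by move=> y; apply: continuousB; [exact: coord_continuous|exact: cst_continuous].
by move=> y; exact: continuousM (h y) (h y).
Qed.

(** A closed subset of a box. Points are transposed because [rV_compact] speaks of row vectors. *)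
Lemma compact_polyhedron_trmx (M : R) : (forall x, P x -> enorm x <= M) ->
  compact [set y : 'rV[R]_d | P y^T].
Proof.
move=> PM.
have Mc : compact [set v : 'rV[R]_d | forall i, v ord0 i \in `[- M, M]].
  apply: (@rV_compact _  _ (fun=> `[- M, M]%classic)).
  by move=> _; exact: segment_compact.
apply: subclosed_compact Mc _; last first.
  move=> y /PM yM j; rewrite in_itv/= -ler_norml.
  by apply: le_trans yM; have := enorm_coord y^T j; rewrite mxE.
have -> : [set y : 'rV[R]_d | P y^T] =
    \bigcap_(i in [set: 'I_n])
      ((fun y : 'rV_d => dotv (row i A)^T y^T) @^-1` [set t | t <= b i 0]).
  apply/seteqP; split => y /= h i; first by move=> _ /=; rewrite -mulmx_dotv.
  by have := h i I; rewrite /= -mulmx_dotv.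
apply: closed_bigI => i _; apply: preimage_closed; last exact: closed_le.
by move=> y _; exact: continuous_dotv_trmx.
Qed.

(* The point of [P] farthest from [w] is exposed by its difference with [w]. *)
Lemma farthest_vertex (M : R) (x0 w : 'cV[R]_d) :
  P x0 -> (forall x, P x -> enorm x <= M) ->
  exists2 v, is_vertex P v & forall x, P x -> enorm (x - w) <= enorm (v - w).
Proof.
move=> Px0 PM.
have [|||y] := @compact_EVT_max _ _ (fun y : 'rV[R]_d => dotv (y^T - w) (y^T - w))
    [set y : 'rV[R]_d | P y^T].
- by exists x0^T; rewrite /= trmxK.
- exact: compact_polyhedron_trmx PM.
- exact/continuous_subspaceT/continuous_sqdist_trmx.
rewrite inE /= => Py ymax; pose v := y^T.
have vmax x : P x -> dotv (x - w) (x - w) <= dotv (v - w) (v - w).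
  by move=> Px; have := ymax x^T; rewrite inE/= trmxK; exact.
(* Expanding |x - w|^2 around [v] shows that the functional [v - w] is maximal over [P] at [v] and
   nowhere else. *)
have hx x : P x -> dotv (x - v) (x - v) <= 2 * (dotv (v - w) v - dotv (v - w) x).
  move=> /vmax; rewrite !dotvBl !dotvBr !(dotvC x) !(dotvC w); lra.
exists v; last by move=> x /vmax h; rewrite ler_sqrt// dotv_ge0.
exists (v - w), (dotv (v - w) v); split.
  by move=> x /hx; have := dotv_ge0 (x - v); lra.
apply/seteqP; split => x /=; first by move=> ->.
move=> [/hx h hv]; apply/eqP; rewrite -subr_eq0 -dotv_eq0 eq_le dotv_ge0 andbT.
by move: h; rewrite hv; lra.
Qed.

End FarthestVertex.

(** * Polyhedra close to the unit ball *)

Section NearBallPolyhedron.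
Variables (R : realType) (n d : nat) (A U : 'M[R]_(n, d)) (b : 'cV[R]_n).
Variable kappa : R.
Local Notation P := (polyhedron A b).
(* 9/2 d kappa is lost to the perturbation and 1/2 d kappa to the net. *)
Local Notation H := (5 * (d%:R * kappa)).
Hypothesis d2 : (2 <= d)%N.
Hypothesis kappa0 : 0 < kappa.
Hypothesis dkappa : d%:R * kappa <= 1 / 32.
Hypothesis U1 : forall i, enorm (row i U)^T <= 1.
Hypothesis Unet : forall x, exists i,
  (1 - d%:R * kappa / 2) * enorm x <= dotv (row i U)^T x.
(* The bound is ((7 / 10) * (9 / 2) * d * kappa) ^ 2 / 2: by Cauchy-Schwarz it moves
   a slack by at most (7 / 10) * (9 / 2) * d * kappa * max(1, |x|). *)
Hypothesis close : forall i,
  \sum_(j < d) (A i j - (7 / 10) * U i j) ^+ 2 + (b i 0 - 7 / 10) ^+ 2 <=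
    3969 / 800 * (d%:R * kappa) ^+ 2.

Lemma constraint_perturbation x X i : enorm x <= X -> 1 <= X ->
  `|((A *m x) i 0 - b i 0) - 7 / 10 * (dotv (row i U)^T x - 1)|
    <= 7 / 10 * (9 / 2 * (d%:R * kappa)) * X.
Proof.
move=> xX X1; set q := d%:R * kappa.
have q0 : 0 <= q by rewrite mulr_ge0// ltW.
pose z := (row i A)^T - (7 / 10) *: (row i U)^T; pose t := b i 0 - 7 / 10.
have zt : enorm z ^+ 2 + t ^+ 2 <= 3969 / 800 * q ^+ 2.
  rewrite enorm_sqr; apply: le_trans (close i); rewrite lerD2r.
  by apply: ler_sum => j _; rewrite !mxE -expr2.
have -> : (A *m x) i 0 - b i 0 - 7 / 10 * (dotv (row i U)^T x - 1) = dotv z x - t.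
  by rewrite /z /t dotvBl dotvZl mulmx_dotv; ring.
have h1 : `|dotv z x - t| <= enorm z * X + `|t|.
  apply: le_trans (ler_normB _ _) _; rewrite lerD2r.
  apply: le_trans (_ : enorm z * enorm x <= _); last first.
    by rewrite ler_wpM2l// enorm_ge0.
  rewrite ler_norml; have := cauchy_schwarz z x; have := cauchy_schwarz (- z) x.
  by rewrite dotvNl enormN; lra.
apply: le_trans h1 _.
have X0 : 0 <= X by apply: le_trans X1.
have K0 : 0 <= 7 / 10 * (9 / 2 * q) * X by rewrite mulr_ge0//; lra.
rewrite -ler_sqr ?nnegrE ?K0 ?addr_ge0 ?mulr_ge0 ?enorm_ge0//.
have t2 : t ^+ 2 = `|t| ^+ 2 by rewrite real_normK ?num_real.
rewrite t2 in zt; move: zt; set e := enorm z; set s := `|t| => zt.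
(* Cauchy-Schwarz for (e, s) and (X, 1); then [X >= 1] gives X^2 + 1 <= 2 X^2, which uses up the
   halving in [close]. *)
apply: le_trans (_ : (e ^+ 2 + s ^+ 2) * (X ^+ 2 + 1) <= _).
  by have := sqr_ge0 (e - s * X); lra.
have X2 : 1 <= X ^+ 2 by rewrite expr_ge1.
apply: le_trans (_ : 3969 / 800 * q ^+ 2 * (2 * X ^+ 2) <= _); last by lra.
apply: ler_pM => //; last by lra.
- by rewrite addr_ge0 ?sqr_ge0.
- by rewrite addr_ge0 ?sqr_ge0.
Qed.

Lemma dkappa_gt0 : 0 < d%:R * kappa.
Proof. by rewrite mulr_gt0// ltr0n; lia. Qed.

(** Up to the common factor 7/10, the unperturbed slack is at least 5 d kappa and the noise at most
    9/2 d kappa. *)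
Lemma near_ball_inside x i : enorm x <= 1 - H -> (A *m x) i 0 < b i 0.
Proof.
have q0 := dkappa_gt0; have q1 := dkappa; set q := d%:R * kappa in q0 q1 * => xH.
have x1 : enorm x <= 1 by lra.
have := constraint_perturbation i x1 (lexx 1); rewrite ler_norml => /andP[_].
have := cauchy_schwarz (row i U)^T x; rewrite -/q mulr1 => h1 h2.
have : enorm (row i U)^T * enorm x <= 1 * enorm x.
  by rewrite ler_wpM2r ?enorm_ge0.
lra.
Qed.

(** Only |x| > 1 matters, where the noise scales with |x|. With q = d kappa, a net row nearly
    parallel to [x] gives (1 - q/2) |x| - 1 <= 9/2 q |x|; the two losses add up to [H]. *)
Lemma inside_near_ball x : P x -> enorm x * (1 - H) <= 1.
Proof.
have q0 := dkappa_gt0; have q1 := dkappa; set q := d%:R * kappa in q0 q1 * => Px.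
have [x1|x1] := leP (enorm x) 1.
  by apply: le_trans (ler_pM _ _ x1 (_ : _ <= 1)) _; rewrite ?enorm_ge0; lra.
have [i hi] := Unet x.
have := constraint_perturbation i (lexx _) (ltW x1); rewrite ler_norml => /andP[+ _].
by have := Px i; rewrite -/q; rewrite -/q in hi; lra.
Qed.

Hypothesis nondegenerate : forall x : 'cV[R]_d,
  (forall j, `|x j 0| <= 2) -> (#|tight A b x| <= d)%N.

Let bound : R := Num.sqrt (d%:R - 1) / (24 * Num.sqrt kappa).

(** [walk_length] is applied with inner radius s = 1 - H and outer radius 1 / s. The bound w^2 <= 40
    d kappa s^2 yields (d - 1)^2 <= 160 d kappa k^2, and d <= 2 (d - 1) leaves d - 1 <= 320 kappa
    k^2, within the 24^2 = 576 of the claim. *)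
Lemma comb_dist_ge u v : is_vertex P u -> is_vertex P v ->
  2 * (1 - H) <= enorm (u - v) -> (bound%:E <= comb_dist P u v)%E.
Proof.
move=> Pu Pv uv; apply: le_ereal_inf_tmp => _ [k /= wk <-]; rewrite lee_fin.
have q0 := dkappa_gt0; have q1 := dkappa.
have Hq : exists q, q = d%:R * kappa by eexists.
case: Hq => q qE; rewrite -qE in q0 q1 uv.
pose s := 1 - 5 * q; have s1 : s <= 1 by rewrite /s; lra.
have s0 : 27 / 32 <= s by rewrite /s; lra.
have ss : 71 / 100 <= s ^+ 2.
  have : (27 / 32) * (27 / 32) <= s * s by apply: ler_pM; lra.
  by rewrite expr2; lra.
have ssl : s ^+ 2 <= 1 by rewrite expr_le1//; lra.
(* Used twice: w < s amounts to 1 < 2 s^4, and the bound on w^2 below absorbs a factor 2 s^4. *)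
have s4 : 1 / 2 < s ^+ 2 * s ^+ 2.
  have : 71 / 100 * (71 / 100) <= s ^+ 2 * s ^+ 2 by apply: ler_pM; lra.
  by lra.
pose w := Num.sqrt (s ^- 2 - s ^+ 2).
have s20 : 0 < s ^+ 2 by lra.
have w2 : w ^+ 2 = s ^- 2 - s ^+ 2.
  rewrite sqr_sqrtr// subr_ge0; apply: (le_trans ssl).
  by rewrite invf_ge1.
have sv : s ^- 2 * (s ^+ 2 * s ^+ 2) = s ^+ 2 by field; rewrite gt_eqF//; lra.
have wr : w < s.
  rewrite -ltr_sqr ?nnegrE ?sqrtr_ge0//; last by lra.
  rewrite w2; suff : s ^- 2 < 2 * s ^+ 2 by lra.
  rewrite -(ltr_pM2r (_ : 0 < s ^+ 2)); last by lra.
  by rewrite mulVf; lra.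
have Pball x : P x -> enorm x <= 2.
  move=> /inside_near_ball; rewrite -qE -/s.
  have := enorm_ge0 x; set X := enorm x => X0 h.
  have : X * (27 / 32) <= X * s by rewrite ler_wpM2l.
  lra.
have nd x : P x -> (#|tight A b x| <= d)%N.
  move=> /Pball x2; apply: nondegenerate => j.
  exact: le_trans (enorm_coord x j) x2.
have Pin x i : enorm x < s -> (A *m x) i 0 < b i 0.
  by move=> xs; apply: near_ball_inside; rewrite -qE ltW.
have Pout x : P x -> enorm x ^+ 2 <= s ^+ 2 + w ^+ 2.
  move=> /inside_near_ball; rewrite -qE -/s w2 => xs.
  rewrite addrC subrK -exprVn ler_sqr ?nnegrE ?enorm_ge0//; last first.
    by rewrite invr_ge0; lra.
  by rewrite -[leRHS]mul1r ler_pdivlMr//; lra.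
have s0' : 0 <= s by lra.
have := walk_length nd (r := s) (w := w) s0' (sqrtr_ge0 _) Pin Pout d2 wr wk Pv uv.
set p : R := d.-1%:R => hk.
have pE : p = d%:R - 1 by rewrite -[in RHS](prednK (ltnW d2)) -natr1 addrK.
have p1 : d%:R <= 2 * p.
  by rewrite pE; have : 2 <= d%:R :> R by [rewrite ler_nat]; lra.
have p0 : 0 < p by rewrite ltr0n -subn1 subn_gt0.
rewrite /bound -pE ler_pdivrMr; last by rewrite mulr_gt0// sqrtr_gt0.
rewrite -ler_sqr ?nnegrE ?mulr_ge0 ?sqrtr_ge0//.
rewrite (sqr_sqrtr (ltW p0)) !exprMn (sqr_sqrtr (ltW kappa0)).
have hk2 : (p * s) ^+ 2 <= (2 * k%:R * w) ^+ 2.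
  have a0 : 0 <= p * s by rewrite mulr_ge0// ltW.
  have b0 : 0 <= 2 * k%:R * w by rewrite mulr_ge0// sqrtr_ge0.
  by rewrite ler_sqr ?nnegrE.
(* w^2 s^2 = 1 - s^4 = (1 - s) (1 + s) (1 + s^2) <= 4 (1 - s) = 20 q, and 1 <= 2 s^4. *)
have w8 : w ^+ 2 <= 40 * q * s ^+ 2.
  rewrite w2 -(ler_pM2r (_ : 0 < s ^+ 2)) ?mulrBl ?mulVf; try lra.
  have : 1 - s ^+ 2 * s ^+ 2 <= 20 * q.
    rewrite (_ : 1 - _ = (1 - s) * ((1 + s) * (1 + s ^+ 2))); last by ring.
    have -> : 20 * q = (1 - s) * (2 * 2) by rewrite /s; ring.
    by apply: ler_wpM2l; [lra|apply: ler_pM; lra].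
  move=> h; apply: le_trans h _.
  have : 40 * q * (1 / 2) <= 40 * q * (s ^+ 2 * s ^+ 2) by rewrite ler_wpM2l; lra.
  lra.
have pq : p ^+ 2 <= 160 * q * k%:R ^+ 2.
  rewrite -(ler_pM2r (_ : 0 < s ^+ 2)); last by lra.
  move: hk2; rewrite !exprMn => hk2; apply: le_trans hk2 _.
  have : k%:R ^+ 2 * w ^+ 2 <= k%:R ^+ 2 * (40 * q * s ^+ 2).
    by rewrite ler_wpM2l// sqr_ge0.
  by lra.
rewrite -(ler_pM2r p0); apply: le_trans (_ : 160 * q * k%:R ^+ 2 <= _).
  by rewrite -expr2.
have : q * k%:R ^+ 2 <= 2 * p * kappa * k%:R ^+ 2.
  by rewrite qE ler_wpM2r ?sqr_ge0// ler_wpM2r// ltW.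
have : 0 <= p * kappa * k%:R ^+ 2 by rewrite !mulr_ge0 ?sqr_ge0// ltW.
lra.
Qed.

Lemma near_ball_radial_point x : x != 0 -> P ((1 - H) / enorm x *: x).
Proof.
move=> x0 i; apply/ltW/near_ball_inside; rewrite enormZ.
have nx : 0 < enorm x by rewrite lt_neqAle eq_sym enorm_eq0 x0 enorm_ge0.
have h : 0 <= 1 - H by have := dkappa; lra.
by rewrite ger0_norm ?divr_ge0 ?divfK ?gt_eqF// ltW.
Qed.

(** [P] contains the points of norm 1 - H in the directions [c] and [- c], so [c] drops by at least
    2 (1 - H) |c| from [u] to [v]; Cauchy-Schwarz turns this into a distance. *)
Lemma optimal_vertices_far c u v : c != 0 ->
  maximizing_vertex P c u -> minimizing_vertex P c v -> 2 * (1 - H) <= enorm (u - v).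
Proof.
move=> c0 [_ umax] [_ vmin].
have nc : 0 < enorm c by rewrite lt_neqAle eq_sym enorm_eq0 c0 enorm_ge0.
have nc0 : - c != 0 by rewrite oppr_eq0.
have := umax _ (near_ball_radial_point c0); have := vmin _ (near_ball_radial_point nc0).
rewrite enormN !dotvZr dotvNr -enorm_sqr.
have -> : (1 - H) / enorm c * enorm c ^+ 2 = (1 - H) * enorm c by field; rewrite gt_eqF.
have -> : (1 - H) / enorm c * - enorm c ^+ 2 = - ((1 - H) * enorm c) by field; rewrite gt_eqF.
move=> h1 h2; rewrite -(ler_pM2l nc).
by apply: le_trans (cauchy_schwarz _ _); rewrite dotvBr; lra.
Qed.

(** The diameter is a supremum over vertices, so some must be exhibited. One is farthest from the
    origin, hence of norm at least 1 - H; the other is farthest from the first, and so at least as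
    far as the point of norm 1 - H on the opposite ray. *)
Lemma far_vertices : exists u v,
  [/\ is_vertex P u, is_vertex P v & 2 * (1 - H) <= enorm (u - v)].
Proof.
have H1 : 0 < 1 - H by have := dkappa; lra.
have PM x : P x -> enorm x <= (1 - H)^-1.
  by move=> /inside_near_ball h; rewrite -[leRHS]mul1r ler_pdivlMr.
have P0 : P 0.
  by move=> i; apply/ltW/near_ball_inside; rewrite -(scale0r 0) enormZ normr0 mul0r ltW.
have e0 : const_mx 1 != 0 :> 'cV[R]_d.
  apply/eqP => /colP /(_ (Ordinal (ltnW d2))); rewrite !mxE => /eqP.
  by rewrite oner_eq0.
have [u Pu umax] := farthest_vertex 0 P0 PM.
have u1 : 1 - H <= enorm u.
  have := umax _ (near_ball_radial_point e0); rewrite !subr0; apply: le_trans.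
  rewrite enormZ ger0_norm; last by rewrite divr_ge0 ?enorm_ge0// ltW.
  by rewrite divfK// enorm_eq0.
have u0 : u != 0 by rewrite -enorm_eq0 gt_eqF//; lra.
have [v Pv vmax] := farthest_vertex u P0 PM.
exists v, u; split => //; have nu0 : - u != 0 by rewrite oppr_eq0.
have := vmax _ (near_ball_radial_point nu0); apply: le_trans.
rewrite enormN (_ : _ - u = - (((1 - H) / enorm u + 1) *: u)); last first.
  by rewrite scalerN scalerDl scale1r opprD.
rewrite enormN enormZ ger0_norm; last by rewrite addr_ge0// divr_ge0 ?enorm_ge0// ltW.
by rewrite (mulrDl _ 1 (enorm u)) divfK ?enorm_eq0// mul1r; lra.
Qed.

Lemma comb_diam_ge : (bound%:E <= comb_diam P)%E.
Proof.
have [u [v [Pu Pv uv]]] := far_vertices.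
apply: le_ereal_sup_tmp; exists (comb_dist P u v); last exact: comb_dist_ge.
by exists u => //; exists v.
Qed.

End NearBallPolyhedron.

(** * A net of directions from an integer grid *)

Section SphereNet.
Variables (R : realType) (d m : nat).
Hypothesis m0 : (0 < m)%N.
Hypothesis dm : (d <= m)%N.

Definition grid_vector (g : {ffun 'I_d -> 'I_(m.*2.+1)}) : 'cV[R]_d :=
  \col_j ((g j)%:R - m%:R).

Lemma enorm_normalize_le1 (z : 'cV[R]_d) : enorm ((enorm z)^-1 *: z) <= 1.
Proof.
rewrite enormZ ger0_norm ?invr_ge0 ?enorm_ge0//.
have [->|z0] := eqVneq (enorm z) 0; first by rewrite mulr0.
by rewrite mulVf.
Qed.

(* Rounding [m *: u] towards 0 keeps the norm at most [m]. *)
Lemma grid_vector_near (u : 'cV[R]_d) : enorm u = 1 ->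
  exists g, enorm (grid_vector g) <= m%:R /\
    m%:R - d%:R <= dotv (grid_vector g) u.
Proof.
move=> u1; pose t j := Num.truncn (m%:R * `|u j 0|).
have uj j : `|u j 0| <= 1 by rewrite -u1 enorm_coord.
have tl j : (t j)%:R <= m%:R * `|u j 0| by rewrite Num.Theory.truncn_le mulr_ge0.
have tg j : m%:R * `|u j 0| < (t j).+1%:R by exact: Num.Theory.truncnS_gt.
have tm j : (t j <= m)%N.
  rewrite -(ler_nat R); apply: le_trans (tl j) _.
  by rewrite -[leRHS]mulr1 ler_wpM2l.
have [g gE] : exists g : {ffun 'I_d -> 'I_(m.*2.+1)},
    forall j, grid_vector g j 0 = Num.sg (u j 0) * (t j)%:R.
  exists [ffun j => inord (if (0 <= u j 0)%R then m + t j else m - t j)%N] => j.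
  rewrite !mxE ffunE inordK; last by have := tm j; case: ifP; lia.
  have [uj0|uj0] := lerP 0 (u j 0).
    rewrite natrD addrC addKr; have [u0|u0] := eqVneq (u j 0) 0.
      by rewrite u0 sgr0 mul0r /t u0 normr0 mulr0 truncn0.
    by rewrite gtr0_sg ?mul1r// lt_neqAle eq_sym u0.
  by rewrite natrB// addrAC subrr add0r ltr0_sg// mulN1r.
exists g; split.
  rewrite -ler_sqr ?nnegrE ?enorm_ge0// enorm_sqr.
  apply: le_trans (_ : m%:R ^+ 2 * enorm u ^+ 2 <= _); last by rewrite u1 expr1n mulr1.
  rewrite enorm_sqr mulr_sumr; apply: ler_sum => j _.
  rewrite gE -!expr2 exprMn; apply: le_trans (_ : (t j)%:R ^+ 2 <= _).
    by rewrite ler_piMl ?sqr_ge0// sqr_sg lern1 leq_b1.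
  by rewrite -(real_normK (num_real (u j 0))) -exprMn ler_sqr ?nnegrE ?mulr_ge0.
have -> : m%:R - d%:R = \sum_(j < d) (m%:R * (u j 0 * u j 0) - 1) :> R.
  by rewrite big_split/= -mulr_sumr -/(dotv u u) -enorm_sqr u1 expr1n mulr1
    sumr_const card_ord mulNrn.
(* Coordinatewise, t_j |u_j| >= (m |u_j| - 1) |u_j| >= m u_j^2 - 1, since |u_j| <= 1. *)
apply: ler_sum => j _; rewrite gE mulrAC -normrEsg.
have := uj j; have := tg j; have := normr_ge0 (u j 0).
rewrite -expr2 -(real_normK (num_real (u j 0))) -natr1; set a := `|_|; nra.
Qed.

(** The rows are normalized grid vectors, repeated if [n] exceeds their number. The rounding of m x
    / |x| has norm at most [m], so normalizing it leaves at least (m - d) |x| / m. *)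
Lemma sphere_net (n : nat) : (m.*2.+1 ^ d <= n)%N ->
  exists U : 'M[R]_(n, d), (forall i, enorm (row i U)^T <= 1) /\
    forall x, exists i, (1 - d%:R / m%:R) * enorm x <= dotv (row i U)^T x.
Proof.
move=> mn; pose G : finType := {ffun 'I_d -> 'I_(m.*2.+1)}.
have cG : #|{: G}| = (m.*2.+1 ^ d)%N by rewrite card_ffun !card_ord.
have g0 : G by exact: [ffun=> ord0].
pose v (i : 'I_n) := grid_vector (nth g0 (enum {: G}) i).
pose U := \matrix_(i < n, j < d) ((enorm (v i))^-1 *: v i) j 0.
have UE i : (row i U)^T = (enorm (v i))^-1 *: v i by apply/colP => j; rewrite !mxE.
have vE g : exists i, v i = grid_vector g.
  have gn : (index g (enum {: G}) < n)%N.
    by apply: leq_trans mn; rewrite -cG cardE index_mem mem_enum.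
  by exists (Ordinal gn); rewrite /v nth_index ?mem_enum.
exists U; split => [i|x]; first by rewrite UE enorm_normalize_le1.
have [->|x0] := eqVneq x 0.
  have [i _] := vE g0; exists i.
  by rewrite -(scale0r 0) enormZ normr0 mul0r mulr0 dotvZr mul0r.
have nx : 0 < enorm x by rewrite lt_neqAle eq_sym enorm_eq0 x0 enorm_ge0.
have [|g [gm gu]] := @grid_vector_near ((enorm x)^-1 *: x).
  by rewrite enormZ ger0_norm ?invr_ge0 ?enorm_ge0// mulVf// gt_eqF.
have [i iE] := vE g; exists i; rewrite UE iE dotvZl.
move: gu; rewrite dotvZr mulrC ler_pdivlMr// => gu.
have m1 : 0 < m%:R :> R by rewrite ltr0n.
(* A zero grid vector normalizes to 0; as a rounding it forces (m - d) |x| <= 0, so the bound is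
   trivial. *)
have [g1|g1] := eqVneq (enorm (grid_vector g)) 0.
  have : grid_vector g = 0 by apply/eqP; rewrite -enorm_eq0 g1.
  move=> gE; move: gu; rewrite gE -(scale0r 0) dotvZl mul0r mulr0 => gu.
  have -> : (1 - d%:R / m%:R) * enorm x = (m%:R - d%:R) * enorm x / m%:R.
    by field; rewrite gt_eqF.
  by rewrite ler_pdivrMr// mul0r.
have g2 : 0 < enorm (grid_vector g) by rewrite lt_neqAle eq_sym g1 enorm_ge0.
rewrite [leRHS]mulrC ler_pdivlMr//; apply: le_trans gu.
have -> : (1 - d%:R / m%:R) * enorm x = (m%:R - d%:R) * enorm x / m%:R.
  by field; rewrite gt_eqF.
rewrite mulrAC ler_pdivrMr// ler_wpM2l//.
by rewrite mulr_ge0 ?subr_ge0 ?ler_nat ?enorm_ge0.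
Qed.

End SphereNet.

(** * Independent Gaussian entries *)

Section UnionBound.
Variables (dT : measure_display) (T : measurableType dT) (R : realType).
Variable P : {measure set T -> \bar R}.

Lemma union_bound (I : finType) (A : I -> set T) :
  (forall i, measurable (A i)) ->
  (P (\bigcup_(i in [set: I]) A i) <= \sum_(i : I) P (A i))%E.
Proof.
move=> mA.
have -> : \bigcup_(i in [set: I]) A i = \big[setU/set0]_(i <- index_enum I) A i.
  rewrite -bigcup_seq; apply: eq_bigcupl.
  by split => // i _; rewrite /= mem_index_enum.
elim: (index_enum I) => [|i s IH]; first by rewrite !big_nil measure0.
rewrite !big_cons; apply: le_trans (measureU2 _ _ _) _ => //.
  exact: bigsetU_measurable.
by rewrite leeD2l.
Qed.

End UnionBound.

Section WeightedLaw.
Variable R : realType.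
Import HBNNSimple.

Lemma integral_nnsfun_comp (dT : measure_display) (T : measurableType dT)
    (mu : {measure set T -> \bar R}) (X G : T -> R) (g : {nnsfun R >-> R}) :
  measurable_fun setT X -> measurable_fun setT G -> (forall t, 0 <= G t) ->
  (\int[mu]_t (g (X t) * G t)%:E =
   \sum_(r \in range g) r%:E * \int[mu]_t (\1_(g @^-1` [set r]) (X t) * G t)%:E)%E.
Proof.
move=> mX mG G0.
have m1 r : measurable_fun setT (fun t => \1_(g @^-1` [set r]) (X t) * G t : R).
  apply: measurable_funM => //; apply: measurableT_comp => //.
have p1 r x : (0 <= r%:E * (\1_(g @^-1` [set r]) (X x) * G x)%:E)%E.
  rewrite EFinM muleA mule_ge0//; last by rewrite lee_fin.
  exact: nnfun_muleindic_ge0.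
under eq_integral => t _.
  rewrite fimfunE fsbig_finite//= mulr_suml -sumEFin.
  under eq_bigr do rewrite -mulrA EFinM.
  over.
rewrite fsbig_finite//= ge0_integral_sum//; last first.
  by move=> r; apply: measurable_funeM; exact/measurable_EFinP.
apply: eq_bigr => r _; have [r0|r0] := leP 0 r.
  rewrite ge0_integralZl//; first exact/measurable_EFinP.
  by move=> t _; rewrite lee_fin mulr_ge0.
(* A negative [r] is not a value of the nonnegative [g]. *)
have e0 t : \1_(g @^-1` [set r]) (X t) = 0 :> R.
  rewrite indicE memNset//= => gr.
  by have : 0 <= g (X t) by []; rewrite gr leNgt r0.
under eq_integral do rewrite e0 mul0r mule0.
under [in RHS]eq_integral do rewrite e0 mul0r.
by rewrite integral0 mule0.
Qed.


Lemma cvg_integral_nnsfun_approx_comp (dT : measure_display) (T : measurableType dT)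
    (mu : {measure set T -> \bar R}) (X G : T -> R) (f : R -> R)
    (mEf : measurable_fun setT (EFin \o f)) :
  measurable_fun setT X -> measurable_fun setT G -> (forall t, 0 <= G t) ->
  (forall x, 0 <= f x) ->
  (\int[mu]_t (nnsfun_approx measurableT mEf n (X t) * G t)%:E)%E @[n --> \oo] -->
    (\int[mu]_t (f (X t) * G t)%:E)%E.
Proof.
move=> mX mG G0 f0; set g := nnsfun_approx measurableT mEf.
have gcvg x : EFin \o g^~ x @ \oo --> (f x)%:E.
  by apply: cvg_nnsfun_approx => // y _; rewrite lee_fin.
rewrite (_ : (\int[mu]_t (f (X t) * G t)%:E)%E =
    (\int[mu]_t (limn (fun n => (g n (X t) * G t)%:E)))%E); last first.
  apply: eq_integral => t _; apply/esym/cvg_lim => //.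
  rewrite EFinM; under eq_fun do rewrite EFinM.
  by apply: cvgeZr => //; exact: gcvg.
apply: cvg_monotone_convergence => //.
- move=> n; apply/measurable_EFinP; apply: measurable_funM => //.
  exact: measurableT_comp.
- by move=> n t _; rewrite lee_fin mulr_ge0.
- move=> t _ n m nm; rewrite lee_fin ler_wpM2r//.
  by have /lefP := nd_nnsfun_approx measurableT mEf nm; exact.
Qed.

(** Simple functions and monotone convergence. The weights have two uses: the product of the
    remaining factors in the independence argument, and the density against Lebesgue measure for a
    Gaussian. *)
Lemma ge0_integral_weighted_law (d1 d2 : measure_display)
    (T1 : measurableType d1) (T2 : measurableType d2)
    (mu : {measure set T1 -> \bar R}) (nu : {measure set T2 -> \bar R})
    (X1 G1 : T1 -> R) (X2 G2 : T2 -> R) (f : R -> R) :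
  measurable_fun setT X1 -> measurable_fun setT G1 -> (forall t, 0 <= G1 t) ->
  measurable_fun setT X2 -> measurable_fun setT G2 -> (forall t, 0 <= G2 t) ->
  (forall V, measurable V -> (\int[mu]_t (\1_V (X1 t) * G1 t)%:E =
                              \int[nu]_t (\1_V (X2 t) * G2 t)%:E)%E) ->
  measurable_fun setT f -> (forall x, 0 <= f x) ->
  (\int[mu]_t (f (X1 t) * G1 t)%:E = \int[nu]_t (f (X2 t) * G2 t)%:E)%E.
Proof.
move=> mX1 mG1 G10 mX2 mG2 G20 XG mf f0.
have mEf : measurable_fun setT (EFin \o f) by exact/measurable_EFinP.
have l1 := @cvg_integral_nnsfun_approx_comp _ _ mu _ _ _ mEf mX1 mG1 G10 f0.
have l2 := @cvg_integral_nnsfun_approx_comp _ _ nu _ _ _ mEf mX2 mG2 G20 f0.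
rewrite -(cvg_lim _ l1)// -(cvg_lim _ l2)//; congr (limn _); apply/funext => n.
rewrite !integral_nnsfun_comp//; apply: eq_fsbigr => r _.
by rewrite XG.
Qed.

End WeightedLaw.

Section Independence.
Variables (dT : measure_display) (T : measurableType dT) (R : realType).
Variables (P : probability T R) (I : finType) (Y : I -> T -> R).
Hypothesis mY : forall j, measurable_fun setT (Y j).
Hypothesis indep : mutually_independent P Y.

(** Independence is given for events only, so factors are upgraded from indicators to functions one
    at a time; [S] holds those already upgraded. With the rest of the product as weight,
    [ge0_integral_weighted_law] reduces factor [j] to an indicator, where induction on [S :\ j]
    applies. Empty [S] is independence itself. *)
Lemma expectation_prod_partial (f : I -> R -> R) (e : I -> R) (S : {set I}) :
  (forall j, measurable_fun setT (f j)) -> (forall j x, 0 <= f j x) ->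
  (forall j, (\int[P]_t (f j (Y j t))%:E = (e j)%:E)%E) ->
  forall B : I -> set R, (forall j, measurable (B j)) ->
  (\int[P]_t (\prod_(j : I) (if j \in S then f j (Y j t) else \1_(B j) (Y j t)))%:E =
   (\prod_(j : I) (if j \in S then e j else fine (P (Y j @^-1` B j))))%:E)%E.
Proof.
move=> mf f0 fe; pose F (S : {set I}) B j t : R :=
  if j \in S then f j (Y j t) else \1_(B j) (Y j t).
have mYB j V : measurable V -> measurable (Y j @^-1` V).
  by move=> mV; rewrite -[X in measurable X]setTI; exact: mY.
have F0 S' B j t : 0 <= F S' B j t by rewrite /F; case: ifP.
have mF S' B j : (forall j, measurable (B j)) -> measurable_fun setT (F S' B j).
  move=> mB; rewrite /F; case: (j \in S'); first exact: measurableT_comp.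
  by apply: measurableT_comp => //; exact: measurable_indic.
have [k] := ubnP #|S|; elim: k S => // k IH S Sk B mB.
have [->|[j jS]] := set_0Vmem S.
  under eq_integral => t _.
    rewrite (_ : \prod_j _ = \1_(\bigcap_(j in [set: I]) (Y j @^-1` B j)) t); last first.
      under eq_bigr do rewrite finset.in_set0 indicE.
      rewrite indicE; have [/set_mem tB|tB] := boolP (t \in _).
        rewrite big1// => j _; rewrite mem_set//; exact: tB.
      have [j tBj] : exists j, ~ B j (Y j t).
        apply: contra_notP (negP tB) => /forallNP h; rewrite inE => j _ /=.
        exact: contrapT (h j).
      by rewrite (bigD1 j)//= memNset// mul0r.
    over.
  rewrite integral_indic//; last by apply: fin_bigcap_measurable => // j _; exact: mYB.
  rewrite setIT; apply: (etrans (indep mB)).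
  rewrite -prodEFin; apply: eq_bigr => j _.
  by rewrite finset.in_set0 fineK// fin_num_measure//; exact: mYB.
pose c := \prod_(i | i != j) (if i \in S then e i else fine (P (Y i @^-1` B i))).
pose G t := \prod_(i <- [seq i <- index_enum I | i != j]) F S B i t.
have GE t : G t = \prod_(i | i != j) F S B i t by rewrite /G big_filter.
have c0 : 0 <= c.
  apply: prodr_ge0 => i _; case: ifP => _; last exact/fine_ge0.
  by rewrite -lee_fin -fe integral_ge0// => t _; rewrite lee_fin.
rewrite (bigD1 j)//= jS EFinM -(fe j) -ge0_integralZr//; last first.
- by move=> t _; rewrite lee_fin.
- by apply/measurable_EFinP; exact: measurableT_comp.
under [in LHS]eq_integral do rewrite (bigD1 j)//= jS -GE.
under [in RHS]eq_integral do rewrite -EFinM.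
apply: ge0_integral_weighted_law => //.
- by apply: measurable_prod => i _; exact: mF.
- by move=> t; rewrite GE; apply: prodr_ge0.
move=> V mV; transitivity (P (Y j @^-1` V) * c%:E)%E; last first.
  under eq_integral do rewrite EFinM.
  rewrite ge0_integralZr//; last first.
  - by apply/measurable_EFinP; apply: measurableT_comp => //; exact: measurable_indic.
  - by congr (_ * _)%E; rewrite -(setIT (Y j @^-1` V)) -integral_indic//; exact: mYB.
rewrite (cardsD1 j) jS add1n ltnS in Sk.
pose B' i := if i == j then V else B i.
have mB' i : measurable (B' i) by rewrite /B'; case: (i == j).
have inD i : i != j -> (i \in S :\ j) = (i \in S) by move=> ij; rewrite !inE ij.
transitivity (\int[P]_t (\prod_i F (S :\ j) B' i t)%:E)%E.
  apply: eq_integral => t _; congr EFin.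
  rewrite [in RHS](bigD1 j)//= {1}/F setD11 /B' eqxx GE; congr (_ * _).
  by apply: eq_bigr => i ij; rewrite /F inD// (negPf ij).
rewrite IH// [in LHS](bigD1 j)//= setD11 /B' eqxx EFinM; congr (_ * _)%E.
  by rewrite fineK// fin_num_measure//; exact: mYB.
by congr EFin; apply: eq_bigr => i ij; rewrite inD// (negPf ij).
Qed.

Lemma expectation_prod (f : I -> R -> R) (e : I -> R) :
  (forall j, measurable_fun setT (f j)) -> (forall j x, 0 <= f j x) ->
  (forall j, (\int[P]_t (f j (Y j t))%:E = (e j)%:E)%E) ->
  (\int[P]_t (\prod_(j : I) f j (Y j t))%:E = (\prod_(j : I) e j)%:E)%E.
Proof.
move=> mf f0 fe.
have := expectation_prod_partial finset.setT mf f0 fe (fun=> @measurableT _ _).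
under eq_bigr do rewrite finset.in_setT.
by under eq_integral => t _ do under eq_bigr do rewrite finset.in_setT.
Qed.

End Independence.

Section GaussianVariable.
Variables (dT : measure_display) (T : measurableType dT) (R : realType).
Variables (P : probability T R) (Y : T -> R) (m sigma : R).
Hypothesis sigma0 : 0 < sigma.
Hypothesis mY : measurable_fun setT Y.
Hypothesis normalY : forall V, measurable V -> P (Y @^-1` V) = normal_prob m sigma V.

Lemma normal_expectation (f : R -> R) :
  measurable_fun setT f -> (forall x, 0 <= f x) ->
  (\int[P]_t (f (Y t))%:E =
   \int[lebesgue_measure]_x (f x * normal_pdf m sigma x)%:E)%E.
Proof.
move=> mf f0; under eq_integral do rewrite -[f _]mulr1.
apply: (@ge0_integral_weighted_law _ _ _ _ _ P lebesgue_measure Y (fun=> 1) id) => //.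
- exact: measurable_normal_pdf.
- by move=> x; exact: normal_pdf_ge0.
move=> V mV; under eq_integral do rewrite mulr1.
rewrite (_ : (\int[P]_t _)%E = P (Y @^-1` V)); last first.
  rewrite -[in RHS](setIT (Y @^-1` V)) -integral_indic//.
  by rewrite -[X in measurable X]setTI; exact: mY.
rewrite normalY// /normal_prob [LHS]integral_mkcond; apply: eq_integral => x _.
by rewrite patchE indicE; case: ifP => _; rewrite ?mul1r ?mul0r.
Qed.

(* The integrand is twice the density of the normal law of deviation [2 * sigma]. *)
Lemma normal_square_mgf :
  (\int[P]_t (expR (3 / 8 * ((Y t - m) / sigma) ^+ 2))%:E = 2%:E)%E.
Proof.
have s0 : sigma != 0 by rewrite gt_eqF.
rewrite (@normal_expectation (fun x => expR (3 / 8 * ((x - m) / sigma) ^+ 2))); last 2 first.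
- apply: measurableT_comp => //; apply: measurable_funM => //.
  apply: measurable_funX; apply: measurable_funM => //.
  exact: measurable_funB.
- by move=> x; exact: expR_ge0.
transitivity (\int[lebesgue_measure]_x (2%:E * (normal_pdf m (2 * sigma) x)%:E))%E.
  apply: eq_integral => x _; rewrite -EFinM; congr EFin.
  have s20 : 2 * sigma != 0 by rewrite mulf_neq0.
  rewrite !normal_pdfE// /normal_peak /normal_fun.
  have -> : (2 * sigma) ^+ 2 * pi *+ 2 = 2 ^+ 2 * (sigma ^+ 2 * pi *+ 2).
    by rewrite exprMn -mulrA -mulrnAr.
  rewrite sqrtrM// sqrtr_sqr ger0_norm// invfM.
  (* The exponents match because 3/8 - 1/2 = -1/8 = -1 / (2 * 2^2). *)
  have -> : expR (- (x - m) ^+ 2 / ((2 * sigma) ^+ 2 *+ 2)) =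
      expR (3 / 8 * ((x - m) / sigma) ^+ 2) * expR (- (x - m) ^+ 2 / (sigma ^+ 2 *+ 2)).
    rewrite -expRD; congr expR.
    by rewrite -(mulr_natr (sigma ^+ 2)) -(mulr_natr ((2 * sigma) ^+ 2)); field.
  by move: (expR _) (expR _) (Num.sqrt _)^-1 => p q r; field.
rewrite ge0_integralZl//; first by rewrite integral_normal_pdf mule1.
- by apply/measurable_EFinP; exact: measurable_normal_pdf.
- by move=> x _; rewrite lee_fin normal_pdf_ge0.
Qed.

Lemma normal_interval_le (a b : R) : a <= b ->
  (P (Y @^-1` `[a, b]) <= (normal_peak sigma * (b - a))%:E)%E.
Proof.
move=> ab; rewrite normalY// /normal_prob.
apply: (@le_trans _ _ (\int[lebesgue_measure]_(x in `[a, b]) (normal_peak sigma)%:E))%E.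
  apply: ge0_le_integral => //=.
  - by move=> x _; rewrite lee_fin normal_pdf_ge0.
  - by apply/measurable_EFinP/measurable_funTS; exact: measurable_normal_pdf.
  - by move=> x _; rewrite lee_fin normal_pdf_ub// gt_eqF.
rewrite integral_cst//= lebesgue_measure_itv/= lte_fin.
case: ifP => _; last by rewrite mule0 lee_fin mulr_ge0 ?normal_peak_ge0 ?subr_ge0.
by rewrite -EFinD -EFinM.
Qed.

End GaussianVariable.

Section IndependentGaussians.
Variables (dT : measure_display) (T : measurableType dT) (R : realType).
Variables (P : probability T R) (I : finType) (Y : I -> T -> R).
Variables (mean : I -> R) (sigma : R).
Hypothesis sigma0 : 0 < sigma.
Hypothesis mY : forall j, measurable_fun setT (Y j).
Hypothesis indep : mutually_independent P Y.
Hypothesis normalY : forall j V, measurable V ->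
  P (Y j @^-1` V) = normal_prob (mean j) sigma V.

(** Markov's inequality for exp(3/8 sum), of expectation 2^|S| by independence and
    [normal_square_mgf]. Indices outside [S] carry the constant 1, as [expectation_prod] runs over
    all of [I]. *)
Lemma sqdist_chernoff (S : {set I}) (s : R) :
  (P [set t | (s <= \sum_(j in S) ((Y j t - mean j) / sigma) ^+ 2)%R] <=
     (2 ^+ #|S| * expR (- (3 / 8 * s)))%:E)%E.
Proof.
pose q j t := ((Y j t - mean j) / sigma) ^+ 2.
pose f j x := if j \in S then expR (3 / 8 * ((x - mean j) / sigma) ^+ 2) else 1.
pose e j : R := if j \in S then 2 else 1.
have mf j : measurable_fun setT (f j).
  rewrite /f; case: (j \in S) => //; apply: measurableT_comp => //.
  apply: measurable_funM => //; apply: measurable_funX; apply: measurable_funM => //.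
  exact: measurable_funB.
have f0 j x : 0 <= f j x by rewrite /f; case: ifP => // _; exact: expR_ge0.
have fe j : (\int[P]_t (f j (Y j t))%:E = (e j)%:E)%E.
  rewrite /f /e; case: (j \in S).
    exact: normal_square_mgf sigma0 (mY j) (normalY j).
  by rewrite integral_cst//= probability_setT mule1.
have := expectation_prod mY indep mf f0 fe.
have -> : \prod_j e j = 2 ^+ #|S| by rewrite /e -big_mkcond/= prodr_const.
have mq j : measurable_fun setT (q j).
  apply: measurable_funX; apply: measurable_funM => //.
  exact: measurable_funB.
have msum : measurable_fun setT (fun t => \sum_(j in S) q j t).
  under eq_fun do rewrite -big_filter.
  exact: measurable_sum.
have mE : measurable [set t | s <= \sum_(j in S) q j t].
  have := msum measurableT `[s, +oo[%classic (measurable_itv _).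
  rewrite setTI; congr (measurable _); apply/seteqP.
  by split => t /=; rewrite in_itv/= andbT.
have mprod : measurable_fun setT (fun t => \prod_j f j (Y j t)).
  by apply: measurable_prod => j _; exact: measurableT_comp.
move=> h; rewrite mulrC EFinM -h -ge0_integralZl//; first last.
- by move=> t _; rewrite lee_fin; apply: prodr_ge0 => j _; exact: f0.
- exact/measurable_EFinP.
rewrite -[X in P X]setIT -integral_indic//; apply: ge0_le_integral => //.
- by apply/measurable_EFinP; exact: measurable_indic.
- by apply/measurable_EFinP; apply: measurable_funM.
move=> t _; rewrite -EFinM lee_fin.
have -> : \prod_j f j (Y j t) = expR (3 / 8 * \sum_(j in S) q j t).
  by rewrite mulr_sumr expR_sum [RHS]big_mkcond.
rewrite -expRD indicE; have [|_] := boolP (t \in _); last exact: expR_ge0.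
rewrite inE /= => st; apply: (@le_trans _ _ (expR 0)); first by rewrite expR0.
have qs : s <= \sum_(j in S) q j t by exact: st.
by rewrite ler_expR -mulrN -mulrDr mulr_ge0// addrC subr_ge0.
Qed.

Lemma independent_prod_le (B : I -> set R) (beta : I -> R) :
  (forall j, measurable (B j)) -> (forall j, (P (Y j @^-1` B j) <= (beta j)%:E)%E) ->
  (P (\bigcap_(j in [set: I]) (Y j @^-1` B j)) <= (\prod_j beta j)%:E)%E.
Proof.
move=> mB hB; rewrite (indep mB) -prodEFin.
pose K (x y : \bar R) := (0 <= x)%E /\ (x <= y)%E.
suff [] : K (\prod_j P (Y j @^-1` B j))%E (\prod_j (beta j)%:E)%E by [].
apply: (big_ind2 K) => //.
move=> x1 x2 y1 y2 [x0 x12] [y0 y12]; split; first exact: mule_ge0.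
exact: lee_pmul.
Qed.

End IndependentGaussians.

(** * Degenerate systems *)

Section Degeneracy.
Variables (dT : measure_display) (T : measurableType dT) (R : realType).
Variables (P : probability T R) (n d : nat).
Variables (A : T -> 'M[R]_(n, d)) (b : T -> 'cV[R]_n).
Variables (mean : entry_index n d -> R) (sigma : R).
Hypothesis sigma0 : 0 < sigma.
Hypothesis d0 : (0 < d)%N.
Hypothesis mY : forall j, measurable_fun setT (entry_of A b j).
Hypothesis indep : mutually_independent P (entry_of A b).
Hypothesis normalY : forall j V, measurable V ->
  P (entry_of A b j @^-1` V) = normal_prob (mean j) sigma V.

Variable N : nat.
Hypothesis N0 : (0 < N)%N.
Let cell_index := 'I_((4 * N).+1).
Let cell_point (k : cell_index) : R := k%:R / N%:R - 2.
Let config : finType :=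
  ({set 'I_n} * {ffun 'I_n * 'I_d -> cell_index} * {ffun 'I_d -> cell_index})%type.
Let config_rhs (w : config) (i : 'I_n) : R :=
  \sum_j cell_point (w.1.2 (i, j)) * cell_point (w.2 j).
(** Rounding the factors of a product a y, both in [-2, 2], moves it by at most 2 / N + 2 / N, and a
    row has [d] such products. *)
Let radius : R := 4 * d%:R / N%:R.
Let config_box (w : config) (k : entry_index n d) : set R :=
  match k with
  | inl ij => `[cell_point (w.1.2 ij), cell_point (w.1.2 ij) + N%:R^-1]%classic
  | inr i => if i \in w.1.1
             then `[config_rhs w i - radius, config_rhs w i + radius]%classic
             else setT
  end.
Let config_event (w : config) : set T :=
  if (d < #|w.1.1|)%N
  then \bigcap_(k in [set: entry_index n d]) (entry_of A b k @^-1` config_box w k)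
  else set0.

(* Rounding the entries of [A t] and of a point of excess tightness to multiples of
   [1 / N] confines more than [d] right-hand sides to windows of length O(1 / N);
   the O(N ^ d) choices for the point leave probability O(1 / N). *)
Definition degeneracy_cover : set T := \bigcup_(w in [set: config]) config_event w.

Let N1 : 0 < N%:R :> R. Proof. by rewrite ltr0n. Qed.

Let measurable_config_box w k : measurable (config_box w k).
Proof.
case: k => [ij|i] /=; first exact: measurable_itv.
by case: (i \in _); [exact: measurable_itv|exact: measurableT].
Qed.

Let measurable_config_event w : measurable (config_event w).
Proof.
rewrite /config_event; case: (d < _)%N => //.
apply: fin_bigcap_measurable => // k _.
by rewrite -[X in measurable X]setTI; apply: mY.
Qed.

Lemma measurable_degeneracy_cover : measurable degeneracy_cover.
Proof. by apply: fin_bigcup_measurable. Qed.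

Let cell_point_bounds k : -2 <= cell_point k <= 2.
Proof.
have k4 : k%:R <= 4 * N%:R :> R by rewrite -natrM ler_nat -ltnS.
have : k%:R / N%:R <= 4 :> R by rewrite ler_pdivrMr.
have : 0 <= k%:R / N%:R :> R by rewrite divr_ge0.
by rewrite /cell_point => h1 h2; apply/andP; split; lra.
Qed.

Let cell_of (v : R) : `|v| <= 2 ->
  exists k, cell_point k <= v /\ v <= cell_point k + N%:R^-1.
Proof.
rewrite ler_norml => /andP[v1 v2].
have v0 : 0 <= (v + 2) * N%:R by rewrite mulr_ge0//; lra.
have tr := Num.Theory.truncn_itv v0.
have tN : (Num.truncn ((v + 2) * N%:R) < (4 * N).+1)%N.
  rewrite ltnS -(ler_nat R) natrM; case/andP: tr => tr _; apply: le_trans tr _.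
  by rewrite ler_wpM2r//; lra.
exists (Ordinal tN); rewrite /cell_point /=; move: tr.
set k := Num.truncn _ => /andP[k1 k2].
have h1 : k%:R / N%:R <= v + 2 by rewrite ler_pdivrMr.
have h2 : v + 2 <= (k%:R + 1) / N%:R by rewrite ler_pdivlMr// natr1 ltW.
by rewrite mulrDl mul1r in h2; split; lra.
Qed.

Lemma degeneracy_coverP t (x : 'cV[R]_d) :
  (forall i j, `|A t i j| <= 2) -> (forall j, `|x j 0| <= 2) ->
  (d < #|tight (A t) (b t) x|)%N -> degeneracy_cover t.
Proof.
move=> A2 x2 dx.
have /choice[g hg] ij := cell_of (A2 ij.1 ij.2).
have /choice[l hl] j := cell_of (x2 j).
pose w : config := (tight (A t) (b t) x, finfun g, finfun l).
exists w => //; rewrite /config_event dx => -[ij|i] _ /=.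
  by rewrite ffunE in_itv/=; have [-> ->] := hg ij.
have [it|//] := boolP (i \in _).
have : (A t *m x) i 0 == b t i 0 by move: it; rewrite inE.
move=> /eqP bi; rewrite /= in_itv/= -bi -ler_distl mxE /config_rhs -sumrB.
apply: le_trans (ler_norm_sum _ _ _) _.
apply: (@le_trans _ _ (\sum_(j < d) (4 / N%:R))); last first.
  by rewrite sumr_const card_ord -(mulr_natr (4 / N%:R)) mulrAC.
apply: ler_sum => j _; rewrite !ffunE.
have [a1 a2] := hg (i, j); have [y1 y2] := hl j; rewrite /= in a1 a2.
set a := A t i j in a1 a2 *; set p := cell_point (g _) in a1 a2 *.
set y := x j 0 in y1 y2 *; set q := cell_point (l _) in y1 y2 *.
have -> : a * y - p * q = a * (y - q) + (a - p) * q by ring.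
apply: le_trans (ler_normD _ _) _; rewrite !normrM.
have -> : 4 / N%:R = 2 * N%:R^-1 + N%:R^-1 * 2 :> R by field; rewrite gt_eqF.
apply: lerD; apply: ler_pM => //.
- exact: A2.
- by rewrite ger0_norm ?subr_ge0//; lra.
- by rewrite ger0_norm ?subr_ge0//; lra.
- by rewrite ler_norml; exact: cell_point_bounds.
Qed.

Let peak := normal_peak sigma.
Let peak_ge0 : 0 <= peak := normal_peak_ge0 sigma.

(** The windows depend on the configuration alone, not on [t], so independence applies across [A]
    and [b]. The lower bound on [N] makes the right-hand side factors at most 1, whence [d + 1] of
    them suffice. *)
Let config_event_le w : 8 * d%:R * peak <= N%:R ->
  (P (config_event w) <=
    ((peak / N%:R) ^+ (n * d) * (8 * d%:R * peak / N%:R) ^+ d.+1)%:E)%E.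
Proof.
move=> N8; pose r := 8 * d%:R * peak / N%:R.
have r0 : 0 <= r by rewrite divr_ge0// mulr_ge0.
have r1 : r <= 1 by rewrite ler_pdivrMr// mul1r.
rewrite -/r /config_event; case: ifPn => [dw|_]; last first.
  by rewrite measure0 lee_fin mulr_ge0// exprn_ge0// divr_ge0.
pose beta (k : entry_index n d) : R :=
  match k with inl _ => peak / N%:R | inr i => if i \in w.1.1 then r else 1 end.
apply: le_trans (independent_prod_le indep (beta := beta) _ _) _ => //.
  move=> [ij|i] /=.
    apply: le_trans (normal_interval_le sigma0 (normalY _) _) _.
      by rewrite lerDl invr_ge0.
    by rewrite addrAC subrr add0r.
  case: (i \in _); last by rewrite preimage_setT probability_setT.
  apply: le_trans (normal_interval_le sigma0 (normalY _) _) _.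
    by rewrite lerD2l ge0_cp// /radius divr_ge0// mulr_ge0.
  rewrite lee_fin -/peak (_ : peak * _ = r)// /r /radius.
  by field; rewrite gt_eqF.
rewrite lee_fin big_sumType/= prodr_const -big_mkcond/= prodr_const.
rewrite card_prod !card_ord ler_wpM2l ?exprn_ge0 ?divr_ge0//.
exact: ler_wiXn2l.
Qed.

(** At most 2^n (5 N)^(n d + d) configurations, each of probability O(N^-(n d + d + 1)): one factor
    1 / N survives because [d + 1] tight constraints outnumber the [d] coordinates of the point. *)
Lemma degeneracy_cover_le : 8 * d%:R * peak <= N%:R ->
  (P degeneracy_cover <=
    (2 ^+ n * 5 ^+ (n * d + d) * peak ^+ (n * d) * (8 * d%:R * peak) ^+ d.+1 / N%:R)%:E)%E.
Proof.
move=> N8; apply: le_trans (union_bound P measurable_config_event) _.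
apply: le_trans (lee_sum _ (fun w _ => config_event_le w N8)) _.
have K5 : ((4 * N).+1)%:R <= 5 * N%:R :> R by rewrite -natrM ler_nat; lia.
have subsets : #|{: {set 'I_n}}| = (2 ^ n)%N.
  by rewrite -cardsT -powersetT card_powerset cardsT card_ord.
have configs : #|config|%:R <= 2 ^+ n * (5 * N%:R) ^+ (n * d + d) :> R.
  rewrite !card_prod subsets !card_ffun card_prod !card_ord !natrM !natrX -mulrA.
  by rewrite -exprD ler_wpM2l// lerXn2r ?nnegrE// mulr_ge0.
rewrite sumEFin lee_fin sumr_const -(mulr_natl (_ * _)).
apply: le_trans (ler_wpM2r _ configs) _.
  by rewrite mulr_ge0// exprn_ge0// divr_ge0// !mulr_ge0.
rewrite le_eqVlt; apply/orP; left; apply/eqP; move: (peak) => p; rewrite !exprMn !exprVn !exprS !exprD.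
have XN k : N%:R ^+ k != 0 :> R by rewrite expf_neq0// gt_eqF.
move: (XN (n * d)%N) (XN d) (XN 1%N); rewrite expr1.
move: (N%:R ^+ (n * d)) (N%:R ^+ d) => X Z X0 Z0 N0'.
by field; rewrite ?X0 ?Z0 ?N0'.
Qed.

End Degeneracy.

(** * The smoothed system *)

Section Scales.
Variables (R : realType) (d n : nat) (sigma : R).
Hypothesis d2 : (2 <= d)%N.
Hypothesis sigma0 : 0 < sigma.
Hypothesis sigma4 : sigma < 4.
Local Notation L := (Num.sqrt (ln (4 / sigma))).
Hypothesis small : sigma * L <= 1 / (32 * d%:R).
Hypothesis nE : n = Num.truncn ((4 / sigma) ^+ d).
Hypothesis n2 : (2 <= n)%N.

Lemma ln2_ge_half : 1 / 2 <= ln 2 :> R.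
Proof.
have := @le_ln1Dx R (- 2^-1); rewrite (_ : 1 + - 2^-1 = 2^-1); last by field.
by rewrite lnV ?posrE// => /(_ _); lra.
Qed.

Let s := 4 / sigma.
Let s0 : 0 < s. Proof. by rewrite divr_gt0. Qed.
Let s1 : 1 < s. Proof. by rewrite ltr_pdivlMr// mul1r. Qed.
Let dR : 2 <= d%:R :> R. Proof. by rewrite ler_nat. Qed.
Let L2 : L ^+ 2 = ln s. Proof. by rewrite sqr_sqrtr// ln_ge0// ltW. Qed.

Lemma n_le_pow : n%:R <= s ^+ d.
Proof. by rewrite nE Num.Theory.truncn_le exprn_ge0// ltW. Qed.

Let dL_le : 128 * d%:R * L <= s.
Proof.
have -> : 128 * d%:R * L = sigma * L * (32 * d%:R) * s.
  by rewrite /s; field; rewrite gt_eqF.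
rewrite -[leRHS]mul1r ler_wpM2r ?(ltW s0)//.
by rewrite -ler_pdivlMr// mulr_gt0//; have := dR; lra.
Qed.

(** A bootstrap: n >= 2 gives d ln s >= 1/2, hence d L >= 1; then s >= 128 d L >= 128 yields L >= 1,
    so d L >= 2, s >= 256 and L >= 2. The bound [small] alone would not do, since L tends to 0 as
    sigma approaches 4. *)
Lemma sqrt_ln_ge2 : 2 <= L.
Proof.
have sd : 2 <= s ^+ d by apply: le_trans n_le_pow; rewrite ler_nat.
have lnd : 1 / 2 <= d%:R * ln s.
  rewrite mulr_natl -lnXn//; apply: le_trans ln2_ge_half _.
  by rewrite ler_ln ?posrE// exprn_gt0.
have L0 : 0 <= L := sqrtr_ge0 _.
have h1 : 1 <= d%:R * L.
  rewrite -ler_sqr ?nnegrE ?mulr_ge0// exprMn L2 expr1n expr2.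
  have : 2 * (d%:R * ln s) <= d%:R * (d%:R * ln s).
    by rewrite ler_wpM2r ?mulr_ge0// ln_ge0// ltW.
  by rewrite -mulrA; lra.
have lns k : 2 ^+ k <= s -> k%:R / 2 <= ln s.
  move=> ks; apply: le_trans (_ : ln (2 ^+ k) <= _); last by rewrite ler_ln ?posrE.
  by rewrite lnXn// -(mulr_natl (ln 2)) ler_wpM2l//; have := ln2_ge_half; lra.
have s128 : 2 ^+ 7 <= s by have := dL_le; lra.
have L1 : 1 <= L.
  by rewrite -ler_sqr ?nnegrE// L2 expr1n; have := lns _ s128; lra.
have s256 : 2 ^+ 8 <= s.
  have : 2 * 1 <= d%:R * L by apply: ler_pM.
  by have := dL_le; lra.
by rewrite -ler_sqr ?nnegrE// L2; have := lns _ s256; lra.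
Qed.

(** Take m = floor(3 s / 8) with s = 4 / sigma. Then 2 m + 1 <= s lets the grid fit into [n] rows,
    while m >= s / 4 gives d / m <= d sigma, and L >= 2 supplies the factor L / 2. *)
Lemma net_resolution : exists m, [/\ (0 < m)%N, (d <= m)%N,
  (m.*2.+1 ^ d <= n)%N & d%:R / m%:R <= d%:R * (sigma * L) / 2].
Proof.
have L2' := sqrt_ln_ge2; have hs := dL_le.
have dL : d%:R * 2 <= d%:R * L by rewrite ler_wpM2l.
have sd : 256 * d%:R <= s by lra.
have e0 : 0 <= 3 / 8 * s by rewrite mulr_ge0// ltW.
have := Num.Theory.truncn_itv e0; set m := Num.truncn _ => /andP[m1 m2].
rewrite -natr1 in m2.
have ms : s / 4 <= m%:R by have := dR; lra.
have m0 : 0 < m%:R :> R by have := dR; lra.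
exists m; split.
- by rewrite -(ltr_nat R).
- by rewrite -(ler_nat R); have := dR; lra.
- rewrite nE Num.Theory.truncn_ge_nat; last by rewrite exprn_ge0// ltW.
  rewrite natrX lerXn2r ?nnegrE//; first exact: ltW.
  by rewrite -natr1 -muln2 natrM; have := dR; rewrite -/s; lra.
have h : d%:R / m%:R <= d%:R * sigma.
  rewrite ler_wpM2l// -[sigma]invrK lef_pV2 ?posrE ?invr_gt0//.
  by apply: le_trans ms; rewrite /s mulrAC divff// mul1r.
apply: le_trans h _.
have sL : sigma * 2 <= sigma * L by rewrite ler_pM2l.
by rewrite -[leRHS]mulrA ler_wpM2l//; lra.
Qed.

(** From n <= s^d, n^(d + 1) <= exp(d (d + 1) L^2). With d >= 2 and L >= 2, d (d + 1) L^2 + d + 2 <=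
    7/4 d^2 L^2, below the Chernoff exponent, whose coefficient is 3/8 * 3969/800 > 1.86. *)
Lemma row_failure_le :
  n%:R * (2 ^+ d.+1 * expR (- (3 / 8 * (3969 / 800 * d%:R ^+ 2 * L ^+ 2)))) <=
    n%:R ^- d / 2.
Proof.
have n0 : 0 < n%:R :> R by rewrite ltr0n ltnW.
rewrite ler_pdivlMr// -(ler_pM2l (exprn_gt0 d n0)) [leRHS]divff; last first.
  by rewrite expf_neq0// gt_eqF.
have nd : n%:R ^+ d.+1 <= expR (d%:R * L ^+ 2 * d.+1%:R).
  apply: le_trans (_ : (s ^+ d) ^+ d.+1 <= _).
    by rewrite lerXn2r ?nnegrE ?exprn_ge0 ?(ltW s0)// n_le_pow.
  by rewrite L2 expRM_natr expRM_natl lnK ?posrE.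
have two k : 2 ^+ k <= expR k%:R :> R.
  rewrite -[k%:R]mulr1 expRM_natl; apply: lerXn2r; rewrite ?nnegrE ?expR_ge0//.
  by have := expR_ge1Dx (1 : R); lra.
have two' : 2 ^+ d.+1 * 2 <= expR (d%:R + 2) :> R.
  have -> : 2 ^+ d.+1 * 2 = 2 ^+ d.+2 :> R by rewrite [RHS]exprSr.
  apply: le_trans (two _) _; rewrite ler_expR -!natr1; lra.
have lhs : 2 ^+ d.+1 * 2 * n%:R ^+ d.+1 <=
    expR (d%:R + 2) * expR (d%:R * L ^+ 2 * d.+1%:R).
  by apply: ler_pM => //; rewrite ?mulr_ge0// exprn_ge0.
set e := expR (- _); rewrite [leLHS](_ : _ = 2 ^+ d.+1 * 2 * n%:R ^+ d.+1 * e); last first.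
  by rewrite (exprS n%:R); move: (_ ^+ d) (_ ^+ d.+1) => x y; ring.
apply: le_trans (ler_wpM2r (expR_ge0 _) lhs) _.
rewrite /e -!expRD -[leRHS]expR0 ler_expR -natr1.
have l4 : 4 <= L ^+ 2.
  have := sqrt_ln_ge2; rewrite -ler_sqr ?nnegrE ?sqrtr_ge0//; lra.
have dd : 2 * d%:R <= d%:R ^+ 2 :> R by rewrite expr2 ler_wpM2r.
have : 2 * d%:R * 4 <= d%:R ^+ 2 * L ^+ 2 by apply: ler_pM => //; rewrite ?mulr_ge0.
have : 2 * d%:R * L ^+ 2 <= d%:R ^+ 2 * L ^+ 2 by rewrite ler_wpM2r ?sqr_ge0.
by have := dR; lra.
Qed.

End Scales.

Section SmoothedPolyhedron.
Variables (R : realType) (d : nat) (sigma : R) (n : nat).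
Hypothesis d2 : (2 <= d)%N.
Hypothesis sigma0 : 0 < sigma.
Hypothesis sigma4 : sigma < 4.
Local Notation kappa := (sigma * Num.sqrt (ln (4 / sigma))).
Hypothesis small : kappa <= 1 / (32 * d%:R).
Hypothesis nE : n = Num.truncn ((4 / sigma) ^+ d).
Hypothesis n2 : (2 <= n)%N.
Variable U : 'M[R]_(n, d).
Hypothesis U1 : forall i, enorm (row i U)^T <= 1.
Variables (dT : measure_display) (T : measurableType dT) (P : probability T R).
Variables (A : T -> 'M[R]_(n, d)) (b : T -> 'cV[R]_n).
Hypothesis mY : forall j, measurable_fun setT (entry_of A b j).
Hypothesis indep : mutually_independent P (entry_of A b).

Definition entry_mean (k : entry_index n d) : R :=
  match k with inl ij => 7 / 10 * U ij.1 ij.2 | inr _ => 7 / 10 end.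

Hypothesis normalY : forall j V, measurable V ->
  P (entry_of A b j @^-1` V) = normal_prob (entry_mean j) sigma V.

Definition row_entries (i : 'I_n) : {set entry_index n d} :=
  inr i |: (fun j => inl (i, j)) @: [set: 'I_d]%SET.

Lemma card_row_entries i : #|row_entries i| = d.+1.
Proof.
rewrite cardsU1 card_imset ?cardsT ?card_ord; last by move=> j k [].
by have -> : inr i \notin (fun j : 'I_d => inl (i, j)) @: [set: 'I_d]%SET
  by apply/imsetP => -[].
Qed.

Lemma sum_row_entries (f : entry_index n d -> R) i :
  \sum_(k in row_entries i) f k = \sum_(j < d) f (inl (i, j)) + f (inr i).
Proof.
rewrite big_setU1/=; last by apply/imsetP => -[].
rewrite addrC big_imset/=; last by move=> j k _ _ [].
by congr (_ + _); apply: eq_bigl => j; rewrite finset.in_setT.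
Qed.

Definition close_rows (t : T) : Prop := forall i,
  \sum_(j < d) (A t i j - (7 / 10) * U i j) ^+ 2 + (b t i 0 - 7 / 10) ^+ 2 <=
    3969 / 800 * (d%:R * kappa) ^+ 2.

Let threshold : R := 3969 / 800 * d%:R ^+ 2 * Num.sqrt (ln (4 / sigma)) ^+ 2.
Let far_row i : set T := [set t |
  threshold <= \sum_(k in row_entries i) ((entry_of A b k t - entry_mean k) / sigma) ^+ 2].

Let measurable_far_row i : measurable (far_row i).
Proof.
have msum : measurable_fun setT (fun t =>
    \sum_(k in row_entries i) ((entry_of A b k t - entry_mean k) / sigma) ^+ 2).
  under eq_fun do rewrite -big_filter.
  apply: measurable_sum => k; apply: measurable_funX; apply: measurable_funM => //.
  exact: measurable_funB.
have := msum measurableT `[threshold, +oo[%classic (measurable_itv _).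
rewrite setTI; congr (measurable _); apply/seteqP.
by split => t /=; rewrite in_itv/= andbT.
Qed.

Lemma near_far_row t : (forall i, ~ far_row i t) -> close_rows t.
Proof.
move=> h i; have /negP := h i; rewrite -ltNge sum_row_entries /= => /ltW.
rewrite -(ler_pM2l (exprn_gt0 2 sigma0)) mulrDr mulr_sumr /threshold.
set L := Num.sqrt _ => hi.
have -> : 3969 / 800 * (d%:R * (sigma * L)) ^+ 2 =
  sigma ^+ 2 * (3969 / 800 * d%:R ^+ 2 * L ^+ 2) by ring.
apply: le_trans hi; rewrite le_eqVlt; apply/orP; left; apply/eqP.
have e x : x ^+ 2 = sigma ^+ 2 * (x / sigma) ^+ 2.
  by rewrite -exprMn mulrC divfK// gt_eqF.
by congr (_ + _); [apply: eq_bigr => j _; exact: e|exact: e].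
Qed.

(** Means are at most 7/10 and deviations at most 1, which puts the entries in the box that
    [degeneracy_coverP] discretizes. *)
Lemma close_rows_le2 t : d%:R * kappa <= 1 / 32 -> close_rows t ->
  forall i j, `|A t i j| <= 2.
Proof.
move=> q1 ct i j.
have L0 : 0 <= Num.sqrt (ln (4 / sigma)) := sqrtr_ge0 _.
have q0 : 0 <= d%:R * kappa by rewrite !mulr_ge0// ltW.
have q2 : (d%:R * kappa) ^+ 2 <= 1 / 32 * (1 / 32) by rewrite expr2 ler_pM.
have h : (A t i j - 7 / 10 * U i j) ^+ 2 <= 1 ^+ 2.
  apply: (@le_trans _ _ (3969 / 800 * (d%:R * kappa) ^+ 2)); last by lra.
  apply: le_trans (ct i); rewrite (bigD1 j)//= -addrA lerDl addr_ge0 ?sqr_ge0//.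
  by apply: sumr_ge0 => k _; exact: sqr_ge0.
have Uij : `|U i j| <= 1.
  by apply: le_trans (U1 i); have := enorm_coord (row i U)^T j; rewrite !mxE.
move: h Uij; rewrite -(real_normK (num_real (A t i j - _))) ler_sqr ?nnegrE//.
by rewrite !ler_norml => /andP[h1 h2] /andP[u1 u2]; apply/andP; split; lra.
Qed.

Let bad N : set T := \bigcup_(i in [set: 'I_n]) far_row i `|` degeneracy_cover A b N.

Lemma good_event : exists E : set T, [/\ measurable E,
  forall t, E t -> close_rows t /\ forall x : 'cV[R]_d,
     (forall i j, `|A t i j| <= 2) -> (forall j, `|x j 0| <= 2) ->
     (#|tight (A t) (b t) x| <= d)%N &
  ((1 - n%:R ^- d)%:E <= P E)%E].
Proof.
have d0 : (0 < d)%N by exact: ltnW.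
have n0 : 0 < n%:R :> R by rewrite ltr0n ltnW.
pose p := normal_peak sigma; have p0 : 0 <= p := normal_peak_ge0 sigma.
pose C : R := 2 ^+ n * 5 ^+ (n * d + d) * p ^+ (n * d) * (8 * d%:R * p) ^+ d.+1.
have C0 : 0 <= C by rewrite /C !mulr_ge0 ?exprn_ge0// mulr_ge0.
(* Exceeding the first summand meets the hypothesis of [degeneracy_cover_le]; exceeding the second
   makes C / N at most n^-d / 2. *)
pose N := (Num.truncn (8 * d%:R * p + C * (2 * n%:R ^+ d))).+1.
have Nbig : 8 * d%:R * p + C * (2 * n%:R ^+ d) < N%:R.
  exact: Num.Theory.truncnS_gt.
have C1 : 0 <= C * (2 * n%:R ^+ d) by rewrite mulr_ge0// mulr_ge0// exprn_ge0.
have C2 : 0 <= 8 * d%:R * p by rewrite mulr_ge0.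
have mF : measurable (degeneracy_cover A b N) by exact: measurable_degeneracy_cover.
have mU : measurable (\bigcup_(i in [set: 'I_n]) far_row i).
  exact: fin_bigcup_measurable.
have mbad : measurable (bad N) by exact: measurableU.
exists (~` bad N); split; first exact: measurableC.
  move=> t tbad; split.
    apply: near_far_row => i fi; apply: tbad; left; by exists i.
  move=> x A2 x2; rewrite leqNgt; apply/negP => dx; apply: tbad; right.
  exact: degeneracy_coverP A2 x2 dx.
rewrite probability_setC// EFinB; apply: leeB => //.
apply: le_trans (measureU2 _ _ _) _ => //.
have -> : n%:R ^- d = n%:R ^- d / 2 + n%:R ^- d / 2 :> R by field; rewrite expf_neq0// gt_eqF.
rewrite EFinD; apply: leeD.
  apply: le_trans (union_bound P measurable_far_row) _.
  apply: le_trans (lee_sum _ (fun i _ =>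
    sqdist_chernoff sigma0 mY indep normalY (row_entries i) threshold)) _.
  under eq_bigr do rewrite card_row_entries.
  rewrite sumEFin lee_fin sumr_const card_ord -(mulr_natl (_ * _)).
  exact: row_failure_le.
apply: le_trans (degeneracy_cover_le sigma0 d0 mY indep normalY (ltn0Sn _) _) _.
  by rewrite -/p; apply: ltW; apply: le_lt_trans Nbig; rewrite lerDl.
rewrite lee_fin -/p -/C ler_pdivrMr ?ltr0n// mulrAC ler_pdivlMr//.
rewrite ler_pdivlMl ?exprn_gt0//; apply: ltW; apply: le_lt_trans Nbig.
by rewrite mulrCA (mulrC _ 2) lerDr.
Qed.

End SmoothedPolyhedron.

Theorem theorem5p5 (R : realType) (d : nat) (sigma : R) (n : nat)
  (hd : (2 <= d)%N) (hsigma : 0 < sigma) (hsigma4 : sigma < 4)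
  (hcond : sigma * Num.sqrt (ln (4 / sigma)) <= 1 / (32 * d%:R))
  (hn : n = Num.truncn ((4 / sigma) ^+ d)) :
  let bound : R :=
    Num.sqrt (d%:R - 1) / (24 * Num.sqrt (sigma * Num.sqrt (ln (4 / sigma)))) in
  exists (Abar : 'M[R]_(n, d)) (bbar : 'cV[R]_n),
    (forall i : 'I_n, \sum_(j < d) Abar i j ^+ 2 + bbar i 0 ^+ 2 <= 1) /\
    forall (dT : measure_display) (T : measurableType dT) (P : probability T R)
           (A : T -> 'M[R]_(n, d)) (b : T -> 'cV[R]_n),
      (forall j, measurable_fun setT (entry_of A b j)) ->
      mutually_independent P (entry_of A b) ->
      (forall (i : 'I_n) (k : 'I_d) (V : set R), measurable V ->
          P ((fun t => A t i k) @^-1` V) = normal_prob (Abar i k) sigma V) ->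
      (forall (i : 'I_n) (V : set R), measurable V ->
          P ((fun t => b t i 0) @^-1` V) = normal_prob (bbar i 0) sigma V) ->
      (exists E : set T, [/\ measurable E,
          E `<=` [set t | (bound%:E <= comb_diam (polyhedron (A t) (b t)))%E] &
          ((1 - n%:R ^- d)%:E <= P E)%E]) /\
      (exists E : set T, [/\ measurable E,
          E `<=` [set t | forall (c u v : 'cV[R]_d), c != 0 ->
                    maximizing_vertex (polyhedron (A t) (b t)) c u ->
                    minimizing_vertex (polyhedron (A t) (b t)) c v ->
                    (bound%:E <= comb_dist (polyhedron (A t) (b t)) u v)%E] &
          ((1 - n%:R ^- d)%:E <= P E)%E]).
Proof.
move=> bound.
(* For n = 1 the required probability 1 - n^-d is 0 and the empty event suffices; this disposes of
   sigma close to 4. *)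
have [n1|n2] := leqP n 1.
  exists 0, 0; split=> [i|dT T P A b _ _ _ _].
    by rewrite big1 ?mxE ?expr0n ?addr0// => j _; rewrite mxE expr0n.
  have s1 : 1 <= (4 / sigma) ^+ d.
    by rewrite exprn_ege1// ler_pdivlMr// mul1r ltW.
  have n1' : n = 1%N by apply/eqP; rewrite eqn_leq n1 hn Num.Theory.truncn_gt0.
  have nd1 : n%:R ^- d = 1 :> R by rewrite n1' expr1n invr1.
  by rewrite nd1 subrr; split; exists set0; split.
set kappa := sigma * Num.sqrt (ln (4 / sigma)) in hcond bound *.
have L2 : 2 <= Num.sqrt (ln (4 / sigma)) := sqrt_ln_ge2 hd hsigma hsigma4 hcond hn n2.
have kappa0 : 0 < kappa by rewrite mulr_gt0//; lra.
have d0 : 0 < d%:R :> R by rewrite ltr0n ltnW.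
have q1 : d%:R * kappa <= 1 / 32.
  by move: hcond; rewrite ler_pdivlMr ?mulr_gt0//; lra.
have [m [m0 dm mn md]] := net_resolution hd hsigma hsigma4 hcond hn n2.
have [U [U1 Unet]] := sphere_net R m0 dm mn.
have {}Unet x : exists i, (1 - d%:R * kappa / 2) * enorm x <= dotv (row i U)^T x.
  have [i hi] := Unet x; exists i; apply: le_trans hi.
  by rewrite ler_wpM2r ?enorm_ge0// lerD2l lerN2.
exists (7 / 10 *: U), (const_mx (7 / 10)); split=> [i|dT T P A b mY indep nA nb].
  have : \sum_(j < d) (7 / 10 *: U) i j ^+ 2 = (7 / 10) ^+ 2 * enorm (row i U)^T ^+ 2.
    rewrite enorm_sqr mulr_sumr; apply: eq_bigr => j _.
    by rewrite !mxE exprMn expr2.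
  move=> ->; rewrite mxE.
  have : enorm (row i U)^T ^+ 2 <= 1 by rewrite expr_le1// enorm_ge0.
  lra.
have normalY j V : measurable V ->
    P (entry_of A b j @^-1` V) = normal_prob (entry_mean U j) sigma V.
  case: j => [[i j]|i] mV /=.
    by rewrite (nA i j V mV) mxE.
  by rewrite (nb i V mV) mxE.
have [E [mE hE PE]] := good_event hd hsigma hsigma4 hcond hn n2 mY indep normalY.
have nd t : E t -> forall x : 'cV[R]_d, (forall j, `|x j 0| <= 2) ->
    (#|tight (A t) (b t) x| <= d)%N.
  move=> /hE[ct h] x x2; apply: h x2 => i j.
  exact: (close_rows_le2 hsigma U1 q1 ct).
split; exists E; split => // t Et; have [ct _] := hE t Et.
  exact: comb_diam_ge hd kappa0 q1 U1 Unet ct (nd t Et).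
move=> c u v c0 hu hv.
apply: (comb_dist_ge hd kappa0 q1 U1 Unet ct (nd t Et) hu.1 hv.1).
exact: (optimal_vertices_far hd kappa0 q1 U1 ct c0 hu hv).
Qed.
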